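(* Let $\Omega_1\subset\mathbb{R}^2$ be an open disk of radius $a>0$ (the cross-section of a cylinder) with boundary $\Gamma$, and let $\varepsilon_0,\varepsilon_1,\mu_0,\mu_1>0$. For a frequency $\omega\in\mathbb{C}\setminus(-\infty,0]$ put $k_j=\omega\sqrt{\varepsilon_j\mu_j}$ ($j=0,1$) and $\alpha=i/k_0$. With the boundary integral operators $S^k,D^k,D^{*k},N^k$ on $\Gamma$ given in the context, consider the Burton-Miller operator $$A_{\mathrm{BM}}(\omega)=\begin{pmatrix} \left(D^{k_0}-\tfrac12\right)+\alpha N^{k_0} & -\varepsilon_0\left(S^{k_0}+\alpha\left(D^{*k_0}+\tfrac12\right)\right)\\ -\left(D^{k_1}+\tfrac12\right) & \varepsilon_1 S^{k_1}\end{pmatrix}$$ acting on pairs $(u,q)$ of functions on $\Gamma$, and the direct-indirect mixed Burton-Miller operator $$A_{\mathrm{mix}}(\omega)=\begin{pmatrix} \left(D^{k_0}-\tfrac12\right)+\alpha N^{k_0} & -\varepsilon_0\left(S^{k_0}+\alpha\left(D^{*k_0}+\tfrac12\right)\right) & 0\\ -1 & 0 & S^{k_1}\\ 0 & -1 & \tfrac{1}{\varepsilon_1}\left(D^{*k_1}+\tfrac12\right)\end{pmatrix}$$ acting on triples $(u,q,\phi)$ of functions on $\Gamma$. Then, for every such $\omega$, $A_{\mathrm{mix}}(\omega)$ is injective if and only if $A_{\mathrm{BM}}(\omega)$ is injective. In other words, the set of eigenfrequencies of $A_{\mathrm{mix}}$ equals the set of eigenfrequencies of $A_{\mathrm{B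M}}$.
   Context: Fundamental solution: for complex $k\in\mathbb{C}\setminus(-\infty,0]$, $G^{k}(x-y)=\frac{i}{4}H^{(1)}_0(k|x-y|)$ for $x\neq y$ in $\mathbb{R}^2$, where $H^{(1)}_m$ is the Hankel function of the first kind of order $m$ (principal branch) and $i$ is the imaginary unit. Let $n(x)$ denote the unit normal at $x\in\Gamma$ pointing out of $\Omega_1$, and $ds$ arc length on $\Gamma$. The densities $u,q,\phi$ are complex-valued continuous functions on $\Gamma$. The boundary integral operators are: - single layer: $(S^k\psi)(x)=\int_\Gamma G^k(x-y)\psi(y)\,ds(y)$, $x\in\Gamma$; - double layer: $(D^k\psi)(x)=\int_\Gamma \frac{\partial G^k(x-y)}{\partial n(y)}\psi(y)\,ds(y)$, $x\in\Gamma$; - normal derivative of the single layer: $(D^{*k}\psi)(x)=\int_\Gamma \frac{\partial G^k(x-y)}{\partial n(x)}\psi(y)\,ds(y)$, $x\in\Gamma$; - normal derivative of the double layer (hypersingular operator): $(N^k\psi)(x)=\lim_{h\to0}\, n(x)\cdot\nabla W(x+hn(x))$, where $W(z)=\int_\Gamma \frac{\partial G^k(z-y)}{\partial n(y)}\psi(y)\,ds(y)$ for $z\notin\Gamma$; the limits from $h>0$ and $h<0$ agree, and for merely continuous $\psi$ the limit is taken in the sense of distributions on $\Gamma$. The integrals over $\Gamma$ defining $S^k,D^k,D^{*k}$ for $x\in\Gamma$ are evaluated on the boundary itself (no jump terms included); the jump terms appear explicitly as $\pm\frac12$. In the operator matrices, scalars such as $\tfrac12$ and $-1$ denote the corresponding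 multiples of the identity. Definition (eigenfrequency): for an operator-valued function $A(\omega)$, a frequency $\omega$ is called an eigenfrequency (or eigenvalue) of $A$ if $A(\omega)z=0$ has a non-trivial solution $z\neq0$. Thus $A(\omega)$ is injective exactly when $\omega$ is not an eigenfrequency. *)

(* Defs.v *)
From HB Require Import structures.
From mathcomp Require Import all_boot all_order all_algebra.
From mathcomp Require Import all_classical all_reals all_analysis.

Set Implicit Arguments.
Unset Strict Implicit.
Unset Printing Implicit Defensive.

Import Order.TTheory GRing.Theory Num.Theory.
Import numFieldNormedType.Exports.
(* Imported last, so that Re and Im are the R-valued projections of R[i]. *)
From mathcomp Require Import complex.

Local Open Scope classical_set_scope.
Local Open Scope ring_scope.
Local Open Scope complex_scope.

(* R[i] carries the topology of its absolute value through the alias R[i]^o. *)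

Section Hankel.
Context {R : realType}.
Implicit Types z : R[i].

(* Principal argument, with values in ]-pi, pi]. *)
Definition carg z : R :=
  let t := acos (Re z / ComplexField.Normc.normc z) in if 0 <= Im z then t else - t.

Definition clog z : R[i] := ln (ComplexField.Normc.normc z) +i* carg z.

Definition harmonic_number (m : nat) : R := \sum_(1 <= j < m.+1) j%:R^-1.

Definition euler_gamma : R :=
  lim ((fun m : nat => harmonic_number m - ln m%:R) @ \oo).

Definition csum (u : nat -> R[i]) : R[i] :=
  lim ((series u : nat -> R[i]^o) @ \oo).

Definition besselJ0 z : R[i] :=
  csum (fun m => (-1) ^+ m / (m`!%:R ^+ 2) * (z ^+ 2 / 4) ^+ m).

(* Y_0(z) = 2/pi (log (z/2) + gamma) J_0(z)
            + 2/pi sum_(m >= 1) (-1)^(m+1) H_m (z^2/4)^m / (m!)^2;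
   the term m = 0 vanishes because H_0 = 0. *)
Definition besselY0 z : R[i] :=
  (2 / pi)%:C * ((clog (z / 2) + euler_gamma%:C) * besselJ0 z)
  + (2 / pi)%:C *
    csum (fun m => (-1) ^+ m.+1 * (harmonic_number m)%:C / (m`!%:R ^+ 2)
                   * (z ^+ 2 / 4) ^+ m).

Definition hankel1_0 z : R[i] := besselJ0 z + 'i%C * besselY0 z.

End Hankel.

Section LayerOperators.
Context {R : realType}.
Notation plane := (R * R)%type.
(* Functions on the curve are restrictions of functions on the plane: only
   their values on the curve matter, and they are compared there. *)
Notation density := (plane -> R[i]).
(* Distributions on the curve, as functionals on test functions. *)
Notation distribution := (density -> R[i]).

Definition enorm (x : plane) : R := Num.sqrt (x.1 ^+ 2 + x.2 ^+ 2).

(* For a smooth f this is the product of v with the gradient of f at x. *)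
Definition cderive (f : plane -> R[i]) (x v : plane) : R[i] :=
  'D_v (fun z => Re (f z)) x +i* 'D_v (fun z => Im (f z)) x.

Definition green (k : R[i]) (x : plane) : R[i] :=
  'i%C / 4 * hankel1_0 (k * (enorm x)%:C).

(* The boundary of the open disk of centre c and radius a. *)
Variables (c : plane) (a : R).

Definition Gamma : set plane := [set x | enorm (x - c) = a].

Definition normal (x : plane) : plane := a^-1 *: (x - c).

Definition gamma_param (t : R) : plane := c + (a * cos t, a * sin t).

(* Lebesgue integral over Gamma with respect to arc length, ds = a dt. *)
Definition cint (f : density) : R[i] :=
  (\int[lebesgue_measure]_(t in `[0, 2 * pi]) (Re (f (gamma_param t)) * a))%R
  +i*
  (\int[lebesgue_measure]_(t in `[0, 2 * pi]) (Im (f (gamma_param t)) * a))%R.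

Definition single_layer (k : R[i]) (psi : density) : density :=
  fun x => cint (fun y => green k (x - y) * psi y).

(* Used both on Gamma, where it is the double layer operator, and off Gamma,
   where it is the double layer potential. *)
Definition double_layer (k : R[i]) (psi : density) : density :=
  fun x => cint (fun y => cderive (fun y' => green k (x - y')) y (normal y)
                          * psi y).

Definition adjoint_double_layer (k : R[i]) (psi : density) : density :=
  fun x => cint (fun y => cderive (fun x' => green k (x' - y)) x (normal x)
                          * psi y).

Definition pairing (f chi : density) : R[i] := cint (fun x => f x * chi x).

(* The limit over h -> 0 is two-sided and in the sense of distributions. *)
Definition hypersingular (k : R[i]) (psi : density) : distribution :=
  fun chi =>
    lim ((fun h : R => pairing
            (fun x => cderive (double_layer k psi) (x + h *: normal x)
                              (normal x)) chi : R[i]^o) @ 0^').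

Definition test_function (chi : density) : Prop :=
  forall (m : nat) (t : R),
    derivable (derive1n m (fun s => Re (chi (gamma_param s)))) t 1 /\
    derivable (derive1n m (fun s => Im (chi (gamma_param s)))) t 1.

Definition continuous_density (psi : density) : Prop :=
  {within Gamma, continuous (psi : plane -> R[i]^o)}.

Definition eq_density (f g : density) : Prop :=
  forall x, Gamma x -> f x = g x.

Definition eq_distribution (T T' : distribution) : Prop :=
  forall chi, test_function chi -> T chi = T' chi.

Variables (eps0 eps1 mu0 mu1 : R).

Definition wavenumber (eps mu : R) (omega : R[i]) : R[i] :=
  omega * (Num.sqrt (eps * mu))%:C.

Notation k0 := (wavenumber eps0 mu0).
Notation k1 := (wavenumber eps1 mu1).

Definition alpha (omega : R[i]) : R[i] := 'i%C / k0 omega.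

(* ((D^k0 - 1/2) + alpha N^k0) u - eps0 (S^k0 + alpha (D*^k0 + 1/2)) q;
   everything except N^k0 u is a function, viewed as a regular distribution. *)
Definition burton_miller_row (omega : R[i]) (u q : density) : distribution :=
  fun chi =>
    pairing (fun x => double_layer (k0 omega) u x - u x / 2) chi
    + alpha omega * hypersingular (k0 omega) u chi
    - eps0%:C * pairing (fun x => single_layer (k0 omega) q x
        + alpha omega * (adjoint_double_layer (k0 omega) q x + q x / 2)) chi.

Definition A_BM (omega : R[i]) (z : density * density) :
    distribution * density :=
  let: (u, q) := z in
  (burton_miller_row omega u q,
   fun x => - (double_layer (k1 omega) u x + u x / 2)
            + eps1%:C * single_layer (k1 omega) q x).

Definition A_mix (omega : R[i]) (z : density * density * density) :
    distribution * density * density :=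
  let: (u, q, phi) := z in
  (burton_miller_row omega u q,
   fun x => - u x + single_layer (k1 omega) phi x,
   fun x => - q x + eps1^-1%:C *
              (adjoint_double_layer (k1 omega) phi x + phi x / 2)).

(* Frequencies in the complex plane cut along ]-oo, 0]; in the order of R[i],
   z <= 0 means that z is real and nonpositive. *)
Definition admissible : set R[i] := [set omega | ~~ (omega <= 0)].

Definition dom2 : set (density * density) :=
  [set z | continuous_density z.1 /\ continuous_density z.2].

Definition dom3 : set (density * density * density) :=
  [set z | dom2 z.1 /\ continuous_density z.2].

Definition eq_dom2 (z z' : density * density) : Prop :=
  eq_density z.1 z'.1 /\ eq_density z.2 z'.2.

Definition eq_dom3 (z z' : density * density * density) : Prop :=
  eq_dom2 z.1 z'.1 /\ eq_density z.2 z'.2.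

Definition eq_cod2 (w w' : distribution * density) : Prop :=
  eq_distribution w.1 w'.1 /\ eq_density w.2 w'.2.

Definition eq_cod3 (w w' : distribution * density * density) : Prop :=
  eq_cod2 w.1 w'.1 /\ eq_density w.2 w'.2.

Definition injective_op {U V : Type} (dom : set U) (eqU : U -> U -> Prop)
    (eqV : V -> V -> Prop) (A : U -> V) : Prop :=
  forall z z', dom z -> dom z' -> eqV (A z) (A z') -> eqU z z'.

Definition eigenfrequency {U V : nmodType} (dom : set U)
    (eqU : U -> U -> Prop) (eqV : V -> V -> Prop) (A : R[i] -> U -> V)
    (omega : R[i]) : Prop :=
  exists z, [/\ dom z, ~ eqU z 0 & eqV (A omega z) 0].

Definition A_BM_injective (omega : R[i]) : Prop :=
  injective_op dom2 eq_dom2 eq_cod2 (A_BM omega).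

Definition A_mix_injective (omega : R[i]) : Prop :=
  injective_op dom3 eq_dom3 eq_cod3 (A_mix omega).

Definition A_BM_eigenfrequencies : set R[i] :=
  [set omega | admissible omega /\
               eigenfrequency dom2 eq_dom2 eq_cod2 A_BM omega].

Definition A_mix_eigenfrequencies : set R[i] :=
  [set omega | admissible omega /\
               eigenfrequency dom3 eq_dom3 eq_cod3 A_mix omega].

End LayerOperators.

(* Main.v *)
Require Import Defs.
From mathcomp Require Import all_boot all_order all_algebra.
From mathcomp Require Import all_classical all_reals all_analysis.
From mathcomp Require Import measurable_realfun ring lra.
Set Implicit Arguments.
Unset Strict Implicit.
Unset Printing Implicit Defensive.
Import Order.TTheory GRing.Theory Num.Theory.
Import numFieldNormedType.Exports.
From mathcomp Require Import complex.
Local Open Scope classical_set_scope.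
Local Open Scope ring_scope.
Local Open Scope complex_scope.

(** On a circle every operator of the problem is diagonal in the angle. For
points x, y at distances r, b from the centre and at angular distance t,
|x - y|^2 = r^2 + b^2 - 2 r b cos t, so every kernel depends on the angles only
through the cosine of their difference, and every layer operator is the
convolution over one period with an even periodic integrable function. Such a
convolution maps the exponential e_n(t) = cos nt + i sin nt to a multiple of
itself, and multiplies the n-th coefficient of any continuous density by the
same number ([convolution_mode], [coef_convolution]). Moreover D^k and its
adjoint have the same kernel: on the circle, moving y along n(y) changes
|x - y|^2 as moving x along n(x) does ([adjoint_layer_kernel]).

Hence both operators split into blocks indexed by the integer n. Let p, q be
the multipliers of the row that they share, s and d those of S^{k_1} and of
D^{k_1} + 1/2. The blocks are (p, q; -d, eps1 s) for the Burton-Miller operator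
and (p, q, 0; -1, 0, s; 0, -1, d / eps1) for the mixed one. In the second,
u = s phi and q = (d / eps1) phi leave the single equation
(p s + q d / eps1) phi = 0; so both blocks are singular exactly when
p eps1 s + q d = 0 ([modal_determinant]), which includes the frequencies where
s = d = 0. If this happens for some n, single modes
give an eigenvector of each operator. If it happens for no n, two arguments
with the same image have the same coefficients, and they agree on the circle
because a continuous function whose coefficients all vanish is zero
([mode_complete]).

The analytic facts concern the kernels. The series of J_0 and Y_0 give
G(x) = P(s) + Q(s) ln s with s = |x|^2 and entire P, Q ([green_expansion]).
Thus the single layer kernel has a logarithmic singularity, and the double
layer kernel is bounded because the factor s / a of the normal derivative
cancels the pole of the derivative of ln s; both are integrable
([single_circle_kernel], [double_circle_kernel]). For the hypersingular operator
the double layer potential is differentiated under the integral at distance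
h <> 0 from the circle ([cderive_double_layer]). The result is again a
convolution, so that h enters only through its multiplier, and the limit in h
is a number multiplying the coefficient of the density
([hypersingular_diagonal]). *)

(** * Translation and exchange of integrals over a period *)

Section Translation.
Context {R : realType}.
Implicit Types (x c u v : R) (f : R -> \bar R).
Notation mu := (@lebesgue_measure R).

Lemma measurable_translate c :
  measurable_fun setT ((fun y => y + c) : measurableTypeR R -> measurableTypeR R).
Proof. exact: measurable_funD. Qed.

Lemma preimage_translate c u v :
  (fun y => y + c) @^-1` `[u + c, v + c[ = `[u, v[%classic.
Proof. by apply/seteqP; split => y /=; rewrite !in_itv/= lerD2r ltrD2r. Qed.

Lemma preimage_translate_ocitv c u v :
  (fun y => y + c) @^-1` `]u + c, v + c] = `]u, v]%classic.
Proof. by apply/seteqP; split => y /=; rewrite !in_itv/= lerD2r ltrD2r. Qed.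

(** Both measures give b - a to ]a, b], and these values determine a Borel
measure. *)
Lemma lebesgue_measure_translate c (A : set R) : measurable A ->
  pushforward mu ((fun y => y + c) : measurableTypeR R -> measurableTypeR R) A = mu A.
Proof.
move=> mA.
apply/esym/lebesgue_measure_unique => //=; first exact: measurable_translate.
move=> mphi _ [[a b]] _ <-.
have -> : a = (a - c) + c by rewrite subrK.
have -> : b = (b - c) + c by rewrite subrK.
rewrite /pushforward preimage_translate_ocitv !lebesgue_measure_itv/=.
rewrite !lte_fin ltrD2r -!EFinB; case: ifP => // _; congr EFin; ring.
Qed.

Lemma ge0_integral_translate f c u v :
  measurable_fun setT f -> (forall x, 0 <= f x)%E ->
  (\int[mu]_(y in `[u, v[) f (y + c)%R = \int[mu]_(y in `[(u + c)%R, (v + c)%R[) f y)%E.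
Proof.
move=> mf f0; rewrite -(preimage_translate c).
rewrite -(@ge0_integral_pushforward _ _ _ _ _ _ (@measurable_translate c))//=; last first.
  exact: measurable_funS mf.
apply: eq_measure_integral => //= [|mphi A mA AS]; first exact: measurable_translate.
exact: lebesgue_measure_translate.
Qed.

Variable p : R.

(** Cut the period at x and move the part before x up by one period: both parts
are then translated inside [0, p]. *)
Lemma ge0_integral_periodic f x :
  measurable_fun setT f -> (forall x, 0 <= f x)%E ->
  (forall y, f (y + p)%R = f y) -> 0 <= x <= p ->
  (\int[mu]_(y in `[0%R, p]) f (y - x)%R = \int[mu]_(y in `[0%R, p]) f y)%E.
Proof.
move=> mf f0 fp /andP[x0 xp].
have mfx : measurable_fun setT (fun y : R => f (y - x)).
  by apply: (measurableT_comp mf); exact: measurable_funD.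
rewrite -!integral_itv_bndo_bndc; [|exact: measurable_funTS..].
have cut (g : R -> \bar R) t : 0 <= t <= p -> measurable_fun setT g ->
    (forall x, 0 <= g x)%E ->
    (\int[mu]_(y in `[0%R, p[) g y =
     \int[mu]_(y in `[0%R, t[) g y + \int[mu]_(y in `[t, p[) g y)%E.
  move=> /andP[t0 tp] mg g0; rewrite (@itv_bndbnd_setU _ _ _ (BLeft t)) ?bnd_simp//.
  rewrite ge0_integral_setU//=; first exact: measurable_funTS.
  apply/disj_setPS => y [/=]; rewrite !in_itv/= => /andP[_ yt] /andP[].
  by rewrite leNgt yt.
rewrite (cut _ x)// ?x0// [RHS](cut _ (p - x))// ?subr_ge0 ?xp ?gerBl ?x0//.
rewrite addeC; congr (_ + _)%E.
  by rewrite ge0_integral_translate// subrr.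
under eq_integral do rewrite -fp -addrA (addrC _ p).
by rewrite ge0_integral_translate// add0r addrCA subrr addr0.
Qed.

Lemma integral_periodic f x :
  measurable_fun setT f -> (forall y, f (y + p)%R = f y) -> 0 <= x <= p ->
  (\int[mu]_(y in `[0%R, p]) f (y - x)%R = \int[mu]_(y in `[0%R, p]) f y)%E.
Proof.
move=> mf fp xp; rewrite integralE [RHS]integralE; congr (_ - _)%E.
- rewrite -[RHS](@ge0_integral_periodic (f ^\+)%E x)//.
  + by apply: eq_integral => y _; rewrite !(funeposE,funenegE).
  + exact: measurable_funepos.
  + by move=> y; rewrite !funeposE fp.
- rewrite -[RHS](@ge0_integral_periodic (f ^\-)%E x)//.
  + by apply: eq_integral => y _; rewrite !(funeposE,funenegE).
  + exact: measurable_funeneg.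
  + by move=> y; rewrite !funenegE fp.
Qed.

Lemma integrable_periodic f x :
  measurable_fun setT f -> (forall y, f (y + p)%R = f y) -> 0 <= x <= p ->
  mu.-integrable `[0%R, p] f -> mu.-integrable `[0%R, p] (fun y => f (y - x)%R).
Proof.
move=> mf fp xp /integrableP[_ fi]; apply/integrableP; split.
  apply: measurable_funTS; apply: (measurableT_comp mf).
  exact: measurable_funD.
rewrite (@integral_periodic (fun y => `|f y|)%E)//.
  exact: measurableT_comp.
by move=> y; rewrite fp.
Qed.

End Translation.

Section Fubini.
Context {R : realType}.
Notation mu := (@lebesgue_measure R).
Variable p : R.
Hypothesis p0 : 0 < p.
Notation D := (`[0, p]%classic : set R).

Section kernel.
Variables (F : R -> R -> R) (g : R -> R).
Hypothesis mF : measurable_fun setT (fun z : R * R => F z.1 z.2).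
Hypothesis mg : measurable_fun setT g.
Hypothesis gp : forall y, g (y + p) = g y.
Hypothesis gN : forall y, g (- y) = g y.
Hypothesis ig : mu.-integrable D (EFin \o g).
Hypothesis Fg : forall x y, D x -> D y -> `|F x y| <= g (x - y).

Lemma integrable_section1 x : D x -> mu.-integrable D (EFin \o F x).
Proof.
move=> Dx; have Dx' : 0 <= x <= p by move: Dx => /=; rewrite in_itv.
apply: (@le_integrable _ _ R mu D _ _ (fun y => (g (y - x))%:E)) => //.
- apply/measurable_EFinP/measurable_funTS.
  exact: (measurableT_comp mF (@pair1_measurable _ _ _ _ x)).
- move=> y Dy; rewrite /= !lee_fin.
  by rewrite (le_trans (Fg Dx Dy))// -opprB gN ler_norm.
- apply: (@integrable_periodic _ p (EFin \o g)) => //.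
    exact/measurable_EFinP.
  by move=> y /=; rewrite gp.
Qed.

Lemma integrable_section2 y : D y -> mu.-integrable D (EFin \o F^~ y).
Proof.
move=> Dy; have Dy' : 0 <= y <= p by move: Dy => /=; rewrite in_itv.
apply: (@le_integrable _ _ R mu D _ _ (fun x => (g (x - y))%:E)) => //.
- apply/measurable_EFinP/measurable_funTS.
  exact: (measurableT_comp mF (@pair2_measurable _ _ _ _ y)).
- by move=> x Dx; rewrite /= !lee_fin (le_trans (Fg Dx Dy))// ler_norm.
- apply: (@integrable_periodic _ p (EFin \o g)) => //.
    exact/measurable_EFinP.
  by move=> x /=; rewrite gp.
Qed.

Let f : R * R -> \bar R := (fun z : R * R => (F z.1 z.2)%:E) \_ (D `*` D).

Let mf : measurable_fun setT f.
Proof.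
have mDD : measurable (D `*` D).
  by apply: measurableX; exact: measurable_itv.
apply/(measurable_restrictT _ mDD)/measurable_funTS.
exact/(measurable_EFinP _ (fun z : R * R => F z.1 z.2)).
Qed.

Let f1 x : D x -> (fun y => f (x, y)) = (EFin \o F x) \_ D.
Proof.
move=> Dx; apply/funext => y; rewrite /f /patch.
by have [Dy|Dy] := pselect (D y);
  [rewrite !mem_set|rewrite !memNset//= => -[]].
Qed.

Let f1N x : ~ D x -> (fun y => f (x, y)) = cst 0%E.
Proof.
by move=> Dx; apply/funext => y; rewrite /f /patch memNset//= => -[].
Qed.

Let f2 y : D y -> (fun x => f (x, y)) = (EFin \o F^~ y) \_ D.
Proof.
move=> Dy; apply/funext => x; rewrite /f /patch.
by have [Dx|Dx] := pselect (D x);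
  [rewrite !mem_set|rewrite !memNset//= => -[]].
Qed.

Let f2N y : ~ D y -> (fun x => f (x, y)) = cst 0%E.
Proof.
by move=> Dy; apply/funext => x; rewrite /f /patch memNset//= => -[].
Qed.

Let intf1 x : (\int[mu]_y f (x, y) =
  ((fun x => (\int[mu]_(y in D) F x y)%:E) \_ D) x)%E.
Proof.
have [Dx|Dx] := pselect (D x); last first.
  by rewrite f1N// integral0 /patch memNset.
rewrite f1// -integral_mkcond /patch mem_set// fineK//.
exact: integrable_fin_num (integrable_section1 Dx).
Qed.

Let intf2 y : (\int[mu]_x f (x, y) =
  ((fun y => (\int[mu]_(x in D) F x y)%:E) \_ D) y)%E.
Proof.
have [Dy|Dy] := pselect (D y); last first.
  by rewrite f2N// integral0 /patch memNset.
rewrite f2// -integral_mkcond /patch mem_set// fineK//.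
exact: integrable_fin_num (integrable_section2 Dy).
Qed.

Let if12 : (mu \x mu)%E.-integrable setT f.
Proof.
apply/integrable21ltyP => //.
(* The integral in x is bounded by the same constant for every y. *)
apply: (@le_lt_trans _ _ (\int[mu]_(y in D)
   (\int[mu]_(x in D) `|(g x)%:E|))%E); last first.
  move/integrableP : ig => [_ /=] h.
  rewrite integral_cst//=.
  rewrite lte_mul_pinfty//= ?integral_ge0// ?ge0_fin_numE ?integral_ge0//=.
  by rewrite lebesgue_measure_itv/= lte_fin p0 ltry.
rewrite [leRHS]integral_mkcond; apply: ge0_le_integral => //.
- by move=> y _; exact: integral_ge0.
- apply: (@measurable_fun_fubini_tonelli_G _ _ _ _ R mu (fun z => `|f z|%E)).
    exact: measurableT_comp.
  by move=> z; exact: abse_ge0.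
- by apply/(measurable_restrictT _ (measurable_itv `[0, p])); exact: measurable_cst.
move=> y _.
have [Dy|Dy] := pselect (D y); last first.
  under eq_integral do rewrite [f _](congr1 (@^~ _) (f2N Dy)) /= normr0.
  by rewrite integral0 /patch memNset.
have Dy' : 0 <= y <= p by move: Dy => /=; rewrite in_itv.
rewrite /patch mem_set//.
rewrite -(@integral_periodic _ p (fun x => `|(g x)%:E|%E) y)//; last 2 first.
- by apply: measurableT_comp => //; exact/measurable_EFinP.
- by move=> x; rewrite gp.
rewrite [leRHS]integral_mkcond; apply: ge0_le_integral => //.
- apply: measurableT_comp => //.
  by apply: (measurableT_comp mf); exact: pair2_measurable.
- apply/(measurable_restrictT _ (measurable_itv `[0, p])).
  apply/measurable_EFinP/measurableT_comp => //.
  by apply/measurable_funTS/(measurableT_comp mg); exact: measurable_funD.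
move=> x _; rewrite [f _](congr1 (@^~ x) (f2 Dy)) /patch.
case: ifPn => [/set_mem Dx|]; last by rewrite abse0.
by rewrite /= lee_fin (le_trans (Fg Dx Dy))// ler_norm.
Qed.

Lemma integrable_fubini :
  mu.-integrable D (EFin \o (fun x => \int[mu]_(y in D) F x y)).
Proof.
apply/integrable_mkcond; first exact: measurable_itv.
apply: eq_integrable (integrable_fubini_F if12) => // x _.
by rewrite /fubini_F intf1.
Qed.

(** By periodicity the majorant g (x - y) has the same integral in x for every y,
so that F is integrable on the square even if g is singular at 0. *)
Lemma fubini_periodic :
  \int[mu]_(x in D) (\int[mu]_(y in D) F x y) =
  \int[mu]_(y in D) (\int[mu]_(x in D) F x y).
Proof.
rewrite {1}/Rintegral integral_mkcond.
under eq_integral do rewrite -intf1.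
rewrite (Fubini if12).
under eq_integral do rewrite intf2.
by rewrite -integral_mkcond.
Qed.

End kernel.
End Fubini.

(** * Integrability of the logarithm of the chord *)

Section Log.
Context {R : realType}.
Notation mu := (@lebesgue_measure R).

(** On [a + e, b - e] the integral of f is a difference of two values of F, at
most 2 M; then e tends to 0 by monotone convergence. *)
Lemma integrable_bounded_primitive (f F : R -> R) (a b M : R) : a < b ->
  measurable_fun setT f ->
  (forall x, a < x < b -> 0 <= f x) ->
  (forall x, a < x < b -> {for x, continuous f}) ->
  (forall x, a < x < b -> is_derive x 1 F (f x)) ->
  (forall x, a < x < b -> `|F x| <= M) ->
  mu.-integrable `[a, b] (EFin \o f).
Proof.
move=> ab mf f0 cf dF bF.
apply/integrableP; split; first exact/measurable_EFinP/measurable_funTS.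
rewrite integral_itv_bndoo; last first.
  by apply: measurableT_comp => //; exact/measurable_EFinP/measurable_funTS.
under eq_integral => x.
  rewrite inE/= in_itv/= => xab.
  rewrite ger0_norm ?f0//.
  over.
pose e n : R := (b - a) / 3 / n.+1%:R.
have e0 n : 0 < e n by rewrite /e divr_gt0// divr_gt0// subr_gt0.
have le_e n m : (n <= m)%N -> e m <= e n.
  by move=> nm; rewrite /e ler_pM2l ?divr_gt0 ?subr_gt0// lef_pV2 ?posrE// ler_nat.
have eab n : a + e n < b - e n.
  have : e n <= (b - a) / 3.
    by rewrite /e ler_pdivrMr// ler_peMr ?divr_ge0 ?subr_ge0 ?(ltW ab)// ler1n.
  by move: ab; lra.
have e_lim (d : R) : 0 < d -> exists n, e n < d.
  move=> d0; exists (Num.truncn ((b - a) / 3 / d)).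
  rewrite /e ltr_pdivrMr// -ltr_pdivrMl// [ltLHS]mulrC.
  exact: truncnS_gt.
have -> : `]a, b[%classic = \bigcup_n `[a + e n, b - e n]%classic.
  apply/seteqP; split => [x /=|x [n _] /=]; rewrite !in_itv/=.
    move=> /andP[ax xb]; have xa : 0 < Num.min (x - a) (b - x).
      by rewrite lt_min !subr_gt0 ax.
    have [n] := e_lim _ xa; rewrite lt_min => /andP[h1 h2].
    by exists n => //=; rewrite in_itv/=; apply/andP; split; lra.
  by move: (e0 n) => h /andP[h1 h2]; apply/andP; split; lra.
have inab n x : `[a + e n, b - e n]%classic x -> a < x < b.
  rewrite /= in_itv/= => /andP[h1 h2]; have := e0 n.
  by move=> h; apply/andP; split; lra.
have /cvg_lim <- // : (\int[mu]_(x in `[(a + e n)%R, (b - e n)%R]) (f x)%:E)%E @[n --> \oo]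
    --> (\int[mu]_(x in \bigcup_n `[(a + e n)%R, (b - e n)%R]%classic) (f x)%:E)%E.
  apply: ge0_nondecreasing_set_cvg_integral => //.
  - move=> n m nm; apply/subsetPset/subset_itv; rewrite bnd_simp.
      by rewrite lerD2l le_e.
    by rewrite lerD2l lerN2 le_e.
  - by move=> n; exact/measurable_EFinP/measurable_funTS.
  - by move=> n x /inab xab; rewrite lee_fin f0.
apply: (@le_lt_trans _ _ (2 * M)%:E); last by rewrite ltry.
apply: lime_le.
  apply: ereal_nondecreasing_is_cvgn => n m nm.
  apply: ge0_subset_integral => //.
  - by apply/measurable_EFinP/measurable_funTS.
  - by move=> x /inab xab; rewrite lee_fin f0.
  - apply: subset_itv; rewrite bnd_simp; first by rewrite lerD2l le_e.
    by rewrite lerD2l lerN2 le_e.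
apply: nearW => n.
have dFn x : `[a + e n, b - e n]%classic x -> derivable F x 1.
  by move=> /inab /dF [].
have cFn x : `[a + e n, b - e n]%classic x -> {for x, continuous F}.
  by move=> /dFn /derivable1_diffP /differentiable_continuous.
have ina : `[a + e n, b - e n]%classic (a + e n) by rewrite /= in_itv/= lexx ltW.
have inb : `[a + e n, b - e n]%classic (b - e n) by rewrite /= in_itv/= lexx ltW.
rewrite (@continuous_FTC2 _ f F)//.
- rewrite -EFinB lee_fin.
  have := bF _ (inab _ _ ina); have := bF _ (inab _ _ inb).
  by rewrite !ler_norml => /andP[? ?] /andP[? ?]; lra.
- apply: continuous_in_subspaceT => x; rewrite inE => /inab; exact: cf.
- split.
  + move=> x xin; apply: dFn; move: xin; exact: subset_itv_oo_cc.
  + exact/cvg_at_right_filter/cFn.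
  + exact/cvg_at_left_filter/cFn.
- move=> x xin; rewrite derive1E.
  have [//|_ ->//] := dF x (inab n x _).
  exact: subset_itv_oo_cc.
Qed.

Lemma mul_ln_bound (y : R) : 0 < y <= 1 -> 0 <= - (y * ln y) <= 1.
Proof.
move=> /andP[y0 y1].
rewrite -mulrN -lnV ?posrE// mulr_ge0//=; [|exact: ltW|by rewrite ln_ge0// invf_ge1].
rewrite -ler_pdivlMl// mulr1.
by rewrite ltW// ln_sublinear// invr_gt0.
Qed.

Lemma integrable_ln_ends (p : R) : 0 < p ->
  mu.-integrable `[0, p] (EFin \o (fun t => - ln (t / p) - ln (1 - t / p))).
Proof.
move=> p0.
(* F' is the integrand because (y ln y)' = ln y + 1; here y = t / p. *)
pose F t : R := p * ((1 - t / p) * ln (1 - t / p) - t / p * ln (t / p)) + 2 * t - p.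
have yin t : 0 < t < p -> 0 < t / p < 1.
  by move=> /andP[t0 tp]; rewrite divr_gt0//= ltr_pdivrMr// mul1r.
pose f t : R := - ln (t / p) - ln (1 - t / p).
have dF t : 0 < t < p -> is_derive t 1 F (f t).
  move=> tp; have /andP[t0 tp'] := tp; have /andP[y0 y1] := yin _ tp.
  have d1 := is_derive1_ln y0.
  have y1' : 0 < 1 - t / p by lra.
  have d2 := is_derive1_ln y1'.
  have dt : is_derive t 1 (fun t : R => t / p) p^-1.
    by apply: is_derive_eq; rewrite /GRing.scale/= ?mulr1 ?mulr0 ?addr0 ?add0r.
  have dt' : is_derive t 1 (fun t : R => 1 - t / p) (- p^-1).
    by apply: is_derive_eq; rewrite add0r mul1r.
  have dl : is_derive t 1 (fun t : R => ln (t / p)) ((t / p)^-1 * p^-1).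
    exact: (@is_derive1_comp _ _ (fun t : R => t / p) t _ _ d1 dt).
  have dl' : is_derive t 1 (fun t : R => ln (1 - t / p)) ((1 - t / p)^-1 * - p^-1).
    exact: (@is_derive1_comp _ _ (fun t : R => 1 - t / p) t _ _ d2 dt').
  rewrite /F; apply: is_derive_eq; rewrite /f /GRing.scale/=.
  by field; rewrite subr_eq0 (gt_eqF p0) (gt_eqF t0) (gt_eqF tp').
apply: (@integrable_bounded_primitive f F 0 p (3 * p) p0 _ _ _ dF).
- apply: measurable_funB.
    apply: measurableT_comp => //.
    by apply: (measurableT_comp (@measurable_ln R)); exact: measurable_funM.
  apply: (measurableT_comp (@measurable_ln R)); apply: measurable_funB => //.
  exact: measurable_funM.
- move=> t /yin /andP[y0 y1].
  by rewrite subr_ge0 (@le_trans _ _ 0)// ?oppr_ge0 ln_le0//; lra.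
- move=> t /yin /andP[y0 y1].
  have ct : {for t, continuous (fun t : R => t / p)}.
    by apply: cvgM; [exact: cvg_id|exact: cvg_cst].
  have ct' : {for t, continuous (fun t : R => 1 - t / p)}.
    by apply: cvgB => //; exact: cvg_cst.
  have c1 : {for t, continuous (@ln R \o (fun t : R => t / p))}.
    by apply: continuous_comp => //; exact: continuous_ln.
  have c2 : {for t, continuous (@ln R \o (fun t : R => 1 - t / p))}.
    by apply: continuous_comp => //; apply: continuous_ln; lra.
  by apply: cvgB => //; exact: cvgN.
- move=> t tp; have /andP[t0 tp'] := tp; have /andP[y0 y1] := yin _ tp.
  have y1' : 0 < 1 - t / p <= 1 by apply/andP; split; lra.
  have y0' : 0 < t / p <= 1 by apply/andP; split; lra.
  have /andP[a1 b1] := mul_ln_bound y0'.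
  have /andP[a2 b2] := mul_ln_bound y1'.
  rewrite /F; set u := _ * ln _; set v := t / p * _ in a1 b1 *.
  rewrite -/u in a2 b2.
  have h1 : - p <= p * (u - v) by rewrite -[- p]mulr1 mulNr -mulrN ler_pM2l//; lra.
  have h2 : p * (u - v) <= p by rewrite -[leRHS]mulr1 ler_pM2l//; lra.
  by rewrite ler_norml; apply/andP; split; lra.
Qed.
End Log.

Section CircleLog.
Context {R : realType}.
Notation mu := (@lebesgue_measure R).

(** The function sin z - z cos z increases from 0, so sin z >= z cos z. If
sin z < z / 3, then cos z < 1 / 3, and sin z < 2 / 3 as pi / 2 <= 2; the squares
would add up to less than 1. *)
Lemma sin_ge_third (z : R) : 0 <= z <= pi / 2 -> z / 3 <= sin z.
Proof.
move=> /andP[]; rewrite le_eqVlt => /predU1P[<- _|z0 zpi].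
  by rewrite sin0 mul0r.
have [/andP[_ pi2] _] := pihalf_02_cos_pihalf R.
have s0 : 0 < sin z by apply: sin_gt0_pi; rewrite z0/=; move: (pi_gt0 R); lra.
have : 0 <= sin z - z * cos z.
  pose f (x : R) : R := sin x - x * cos x.
  have df (x : R) : is_derive x 1 f (x * sin x).
    by rewrite /f; apply: is_derive_eq; rewrite /GRing.scale/=; ring.
  have [c] := @MVT _ f (fun x => x * sin x) 0 z z0 (fun x _ => df x)
    (derivable_within_continuous (fun x _ => @ex_derive _ _ _ _ _ _ _ (df x))).
  rewrite in_itv/= => /andP[c0 cz].
  rewrite /f sin0 mul0r !subr0 => ->.
  rewrite mulr_ge0 ?mulr_ge0 ?(ltW c0) ?(ltW z0)//.
  by apply: sin_ge0_pi; rewrite (ltW c0)/=; move: (pi_gt0 R); lra.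
have := cos2Dsin2 z; have cz : 0 <= cos z.
  by apply: cos_ge0_pihalf; rewrite zpi andbT; move: (pi_gt0 R); lra.
move=> e h; rewrite leNgt; apply/negP => h1.
have c1 : cos z < 1 / 3.
  rewrite ltNge; apply/negP => h2.
  have : z * (1/3) <= z * cos z by rewrite ler_pM2l.
  lra.
have : sin z ^+ 2 < (2/3) ^+ 2 by rewrite ltr_pXn2r// ?nnegrE; lra.
have : cos z ^+ 2 < (1/3) ^+ 2 by rewrite ltr_pXn2r// ?nnegrE; lra.
by rewrite !expr2 in e *; lra.
Qed.

(** |x - y|^2 for points x, y at distances r and b from the centre and at angular
distance t. *)
Definition chord2 (r b t : R) : R := r ^+ 2 + b ^+ 2 - 2 * r * b * cos t.

Variable a : R.
Hypothesis a0 : 0 < a.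

Lemma chord2E t : chord2 a a t = (2 * a * sin (t / 2)) ^+ 2.
Proof.
rewrite /chord2 {1}(_ : t = (t / 2) *+ 2); last by rewrite -mulr_natr divfK.
rewrite cos_mulr2n cos2sin2.
ring.
Qed.

(** With y = t / (2 pi) the chord is 2 a sin (pi y), and sin (pi y) is
2 sin (pi y / 2) sin (pi (1 - y) / 2), which [sin_ge_third] bounds below by a
multiple of y (1 - y). *)
Lemma abs_ln_chord2_le t : t \in `[0, 2 * pi] ->
  `|ln (chord2 a a t)| <= `|ln ((2 * a) ^+ 2)| + 2 * ln (18 : R)
    + 2 * (- ln (t / (2 * pi)) - ln (1 - t / (2 * pi))).
Proof.
have pi0 := pi_gt0 R; have p2 : 0 < 2 * pi :> R by lra.
rewrite in_itv/= => /andP[t0 tp].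
have l18 : 0 <= ln 18 :> R by rewrite ln_ge0//; lra.
(* At both endpoints the chord vanishes, and ln 0 = 0. *)
have [t00|tn0] := eqVneq t 0.
  rewrite t00 chord2E !mul0r sin0 mulr0 expr0n/= (ln0 (lexx 0)) normr0 subr0 ln1.
  by rewrite oppr0 addr0 mulr0 addr0 addr_ge0 ?mulr_ge0.
have [tpp|tnp] := eqVneq t (2 * pi).
  rewrite tpp chord2E (_ : 2 * pi / 2 = pi :> R) ?sinpi ?mulr0; last by field.
  rewrite expr0n/= (ln0 (lexx 0)) normr0.
  by rewrite divff ?gt_eqF// subrr ln1 (ln0 (lexx 0)) oppr0 addr0 mulr0 addr0 addr_ge0 ?mulr_ge0.
have {tn0}t0 : 0 < t by rewrite lt_neqAle eq_sym tn0.
have {tnp}tp : t < 2 * pi by rewrite lt_neqAle tnp.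
have s0 : 0 < sin (t / 2) by apply: sin_gt0_pi; lra.
rewrite chord2E exprMn lnM ?posrE ?exprn_gt0 ?mulr_gt0//.
rewrite (lnXn 2 s0)//.
rewrite (le_trans (ler_normD _ _))// -addrA lerD2l.
rewrite normrMn -[leLHS]mulr_natl -mulrDr ler_pM2l//.
rewrite ler0_norm ?ln_le0 ?sin_le1//.
set y := t / (2 * pi).
have y0 : 0 < y by rewrite divr_gt0.
have y1 : 0 < 1 - y by rewrite subr_gt0 ltr_pdivrMr// mul1r.
have h : y * (1 - y) / 18 <= sin (t / 2).
  rewrite (_ : t / 2 = (t / 4) *+ 2); last by rewrite -mulr_natr; field.
  rewrite sin_mulr2n -sinDpihalf.
  have -> : sin (t / 4 + pi / 2) = sin (pi / 2 - t / 4).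
    by rewrite sinD sinB sin_pihalf cos_pihalf; ring.
  have h1 : t / 4 / 3 <= sin (t / 4) by apply: sin_ge_third; apply/andP; split; lra.
  have h2 : (pi / 2 - t / 4) / 3 <= sin (pi / 2 - t / 4).
    by apply: sin_ge_third; apply/andP; split; lra.
  have ypi : t = y * (2 * pi) by rewrite /y divfK// gt_eqF.
  have pi2 : 2 <= pi :> R by apply: pi_ge2.
  have h3 : y / 6 <= sin (t / 4).
    apply: le_trans h1; rewrite ypi.
    have : y * 2 <= y * pi by rewrite ler_pM2l.
    by lra.
  have h4 : (1 - y) / 6 <= sin (pi / 2 - t / 4).
    apply: le_trans h2; rewrite ypi.
    have : (1 - y) * 2 <= (1 - y) * pi by rewrite ler_pM2l.
    by rewrite !mulrBl; lra.
  have : (1 - y) / 6 * (y / 6) <= sin (pi / 2 - t / 4) * sin (t / 4).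
    by rewrite ler_pM//; lra.
  by rewrite mulr2n; nra.
have : ln (y * (1 - y) / 18) <= ln (sin (t / 2)).
  by rewrite ler_ln// posrE divr_gt0// mulr_gt0.
have -> : ln (y * (1 - y) / 18) = ln y + ln (1 - y) - ln 18.
  have e1 : ln (y * (1 - y)) = ln y + ln (1 - y) by apply: lnM; rewrite posrE.
  have e2 : ln (y * (1 - y) / 18) = ln (y * (1 - y)) - ln 18.
    by apply: ln_div; rewrite posrE// mulr_gt0.
  by rewrite e2 e1.
lra.
Qed.

Lemma integrable_ln_chord2 :
  mu.-integrable `[0, 2 * pi] (EFin \o (fun t => ln (chord2 a a t))).
Proof.
have p2 : 0 < 2 * pi :> R by rewrite mulr_gt0// pi_gt0.
pose C : R := `|ln ((2 * a) ^+ 2)| + 2 * ln 18.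
apply: (@le_integrable _ _ R mu _ _ _ (fun t => C%:E +
  2%:E * (- ln (t / (2 * pi)) - ln (1 - t / (2 * pi)))%:E)%E) => //.
- apply/measurable_EFinP/measurable_funTS.
  apply: (measurableT_comp (@measurable_ln R)).
  apply: continuous_measurable_fun => t.
  by apply: cvgB; [exact: cvg_cst|apply: cvgM; [exact: cvg_cst|exact: continuous_cos]].
- move=> t tin; rewrite /= lee_fin (le_trans (abs_ln_chord2_le tin))//.
  exact: ler_norm.
- apply: integrableD => //.
    apply: measurable_bounded_integrable => //.
      by rewrite /= lebesgue_measure_itv/= lte_fin p2 ltry.
    exact: bounded_cst.
  by apply: integrableZl => //; exact: integrable_ln_ends.
Qed.

End CircleLog.

(** * Power series with factorially decaying coefficients *)

Section Entire.
Context {R : realType}.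
Implicit Types (c d : nat -> R) (s : R).

(** The bound of an exponential series: it makes the power series converge
everywhere, and the coefficients of the derivative inherit it. *)
Definition entire_coef c :=
  exists C M : R, [/\ 0 <= C, 0 <= M & forall m, `|c m| <= C * M ^+ m / m`!%:R].

Definition psum c s : R := limn (pseries c s).

Lemma entire_cvg c s : entire_coef c -> cvgn (pseries c s).
Proof.
move=> [C [M [C0 M0 hc]]]; apply: normed_cvg.
apply: (@series_le_cvg _ _ (fun m => C * exp_coeff (M * `|s|) m)).
- by move=> m; exact: normr_ge0.
- by move=> m; rewrite /exp_coeff/= mulr_ge0// divr_ge0// exprn_ge0// mulr_ge0.
- move=> m; rewrite /exp_coeff/= normrM normrX exprMn.
  rewrite (_ : C * _ = (C * M ^+ m / m`!%:R) * `|s| ^+ m); last by ring.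
  by rewrite ler_wpM2r// exprn_ge0.
- exact: (is_cvg_seriesZ (k := C) (is_cvg_series_exp_coeff (M * `|s|))).
Qed.

Lemma entire_diffs c : entire_coef c -> entire_coef (pseries_diffs c).
Proof.
move=> [C [M [C0 M0 hc]]]; exists (C * M), M; split => //; first exact: mulr_ge0.
move=> m; rewrite /pseries_diffs normrM ger0_norm//.
rewrite (le_trans (ler_wpM2l _ (hc m.+1)))//.
rewrite factS natrM exprS.
rewrite (_ : _.+1%:R * _ = C * M * M ^+ m / m`!%:R)//.
by field; rewrite nat1r !pnatr_eq0 -lt0n fact_gt0.
Qed.

Lemma entireD c d : entire_coef c -> entire_coef d ->
  entire_coef (fun m => c m + d m).
Proof.
move=> [C [M [C0 M0 hc]]] [C' [M' [C0' M0' hd]]].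
exists (C + C'), (Num.max M M'); split; [exact: addr_ge0|by rewrite le_max M0|].
move=> m; rewrite (le_trans (ler_normD _ _))// 2!mulrDl lerD//.
- rewrite (le_trans (hc m))// ler_wpM2r// ler_wpM2l//.
  by rewrite lerXn2r ?nnegrE// ?le_max ?lexx ?M0.
- rewrite (le_trans (hd m))// ler_wpM2r// ler_wpM2l//.
  by rewrite lerXn2r ?nnegrE// ?le_max ?lexx ?M0 ?orbT.
Qed.

Lemma entireZ (r : R) c : entire_coef c -> entire_coef (fun m => r * c m).
Proof.
move=> [C [M [C0 M0 hc]]]; exists (`|r| * C), M; split => //.
  exact: mulr_ge0.
by move=> m; rewrite normrM -!mulrA ler_wpM2l// !mulrA.
Qed.

Lemma psumD c d s : entire_coef c -> entire_coef d ->
  psum (fun m => c m + d m) s = psum c s + psum d s.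
Proof.
move=> ec ed; rewrite /psum -lim_seriesD; [|exact: entire_cvg..].
by congr (limn (series _)); apply/funext => n; rewrite /= !fctE mulrDl.
Qed.

Lemma psumZ (r : R) c s : entire_coef c ->
  psum (fun m => r * c m) s = r * psum c s.
Proof.
move=> ec; rewrite /psum -[RHS]lim_seriesZ; last exact: entire_cvg.
by congr (limn (series _)); apply/funext => n; rewrite /= !fctE -mulrA.
Qed.

Lemma is_derive_psum c s : entire_coef c ->
  is_derive s 1 (psum c) (psum (pseries_diffs c) s).
Proof.
move=> ec; apply: (@pseries_snd_diffs _ c (`|s| + 1)).
- exact: entire_cvg.
- exact/entire_cvg/entire_diffs.
- exact/entire_cvg/entire_diffs/entire_diffs.
- by rewrite [ltRHS]ger0_norm ?addr_ge0// ltrDl.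
Qed.

End Entire.

(** * Expansion of the Green function *)

Section ComplexLimits.
Context {R : realType}.
Implicit Types z w : R[i].

Lemma normC_normc z : `|z| = (ComplexField.Normc.normc z)%:C.
Proof. by []. Qed.

Lemma normc_ge_Im z : `|Im z|%:C <= `|z|.
Proof.
have := normc_ge_Re (z * 'i%C); rewrite normrM.
have -> : `|'i%C| = 1 :> R[i].
  by rewrite normC_normc /ComplexField.Normc.normc/= expr0n/= expr1n add0r sqrtr1.
by case: z => x y; rewrite /= mulr1 mulr0 mulr1 sub0r normrN.
Qed.

Lemma normc_le_ReIm z : `|z| <= (`|Re z| + `|Im z|)%:C.
Proof.
rewrite {1}(complexE z) (le_trans (ler_normD _ _))// normrM.
have -> : `|'i%C| = 1 :> R[i].
  by rewrite normC_normc /ComplexField.Normc.normc/= expr0n/= expr1n add0r sqrtr1.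
by rewrite mul1r !normc_def /= expr0n/= !addr0 !sqrtr_sqr rmorphD.
Qed.

Lemma cvgC {T} (F : set_system T) {FF : Filter F} (f : T -> R[i]) z :
  (fun t => Re (f t)) @ F --> Re z -> (fun t => Im (f t)) @ F --> Im z ->
  (f : T -> R[i]^o) @ F --> (z : R[i]^o).
Proof.
move=> hRe hIm; apply/cvgrPdist_lt => -[e ?].
rewrite ltcE/= => /andP[/eqP-> e0].
have e2 : 0 < e / 2 by rewrite divr_gt0.
move/cvgrPdist_lt : hRe => /(_ _ e2) hRe.
move/cvgrPdist_lt : hIm => /(_ _ e2) hIm.
near=> t.
rewrite (le_lt_trans (normc_le_ReIm _))// ltcR.
have h1 : `|Re z - Re (f t)| < e / 2 by near: t.
have h2 : `|Im z - Im (f t)| < e / 2 by near: t.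
by rewrite !raddfB/=; lra.
Unshelve. all: by end_near. Qed.

Lemma cvg_Re {T} (F : set_system T) {FF : Filter F} (f : T -> R[i]) z :
  (f : T -> R[i]^o) @ F --> (z : R[i]^o) -> (fun t => Re (f t)) @ F --> Re z.
Proof.
move=> h; apply/cvgrPdist_lt => e e0.
have e0C : 0 < e%:C by rewrite ltcR.
move/cvgrPdist_lt : h => /(_ _ e0C); apply: filterS => t.
by rewrite -raddfB -[_ < e]ltcR; exact: le_lt_trans (normc_ge_Re _).
Qed.

Lemma cvg_Im {T} (F : set_system T) {FF : Filter F} (f : T -> R[i]) z :
  (f : T -> R[i]^o) @ F --> (z : R[i]^o) -> (fun t => Im (f t)) @ F --> Im z.
Proof.
move=> h; apply/cvgrPdist_lt => e e0.
have e0C : 0 < e%:C by rewrite ltcR.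
move/cvgrPdist_lt : h => /(_ _ e0C); apply: filterS => t.
by rewrite -raddfB -[_ < e]ltcR; exact: le_lt_trans (normc_ge_Im _).
Qed.

End ComplexLimits.

Section Expansion.
Context {R : realType}.
Implicit Types (u v : nat -> R[i]) (s : R) (z w k : R[i]).

Definition centire u :=
  entire_coef (fun m => Re (u m)) /\ entire_coef (fun m => Im (u m)).

Definition cpsum u s : R[i] :=
  psum (fun m => Re (u m)) s +i* psum (fun m => Im (u m)) s.

Lemma centire_bound u (C M : R) : 0 <= C -> 0 <= M ->
  (forall m, `|u m| <= (C * M ^+ m / m`!%:R)%:C) -> centire u.
Proof.
move=> C0 M0 h; split; exists C, M; split => // m; rewrite -lecR.
  exact: le_trans (normc_ge_Re _) (h m).
exact: le_trans (normc_ge_Im _) (h m).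
Qed.

Lemma ReM z w : Re (z * w) = Re z * Re w + - Im z * Im w.
Proof. by case: z => ? ?; case: w => ? ? /=; rewrite mulNr. Qed.

Lemma ImM z w : Im (z * w) = Re z * Im w + Im z * Re w.
Proof. by case: z => ? ?; case: w => ? ? /=. Qed.

Lemma centireZ z u : centire u -> centire (fun m => z * u m).
Proof.
move=> [h1 h2]; split.
  under eq_fun do rewrite ReM; exact/entireD/entireZ/h2/entireZ.
by under eq_fun do rewrite ImM; exact/entireD/entireZ/h1/entireZ.
Qed.

Lemma centireD u v : centire u -> centire v -> centire (fun m => u m + v m).
Proof.
move=> [h1 h2] [h3 h4]; split.
  by under eq_fun do rewrite raddfD/=; exact: entireD.
by under eq_fun do rewrite raddfD/=; exact: entireD.
Qed.

Lemma cpsumZ z u s : centire u -> cpsum (fun m => z * u m) s = z * cpsum u s.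
Proof.
move=> [h1 h2]; rewrite /cpsum.
have e1 : (fun m => Re (z * u m)) = (fun m => Re z * Re (u m) + - Im z * Im (u m)).
  by apply/funext => m; rewrite ReM.
have e2 : (fun m => Im (z * u m)) = (fun m => Re z * Im (u m) + Im z * Re (u m)).
  by apply/funext => m; rewrite ImM.
rewrite e1 e2 !psumD ?psumZ//; [|exact: entireZ..].
by apply/eqP; rewrite eq_complex ReM ImM /= !eqxx.
Qed.

Lemma cpsumD u v s : centire u -> centire v ->
  cpsum (fun m => u m + v m) s = cpsum u s + cpsum v s.
Proof.
move=> [h1 h2] [h3 h4]; rewrite /cpsum.
have e1 : (fun m => Re (u m + v m)) = (fun m => Re (u m) + Re (v m)).
  by apply/funext => m; rewrite raddfD.
have e2 : (fun m => Im (u m + v m)) = (fun m => Im (u m) + Im (v m)).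
  by apply/funext => m; rewrite raddfD.
by rewrite e1 e2 !psumD.
Qed.

Lemma csum_power u s : centire u -> csum (fun m => u m * s%:C ^+ m) = cpsum u s.
Proof.
move=> [h1 h2].
have h m : u m * s%:C ^+ m = (Re (u m) * s ^+ m) +i* (Im (u m) * s ^+ m).
  rewrite -rmorphXn/=; apply/eqP; rewrite eq_complex ReM ImM/=.
  by rewrite !mulr0 !(addr0,add0r) !eqxx.
suff : (series (fun m => u m * s%:C ^+ m) : nat -> R[i]^o) @ \oo -->
    (cpsum u s : R[i]^o) by rewrite /csum => /cvg_lim -> //; exact: norm_hausdorff.
apply: cvgC.
- rewrite [X in X @ _ --> _](_ : _ = pseries (fun m => Re (u m)) s).
    exact: entire_cvg.
  apply/funext => n; rewrite /pseries /series/= raddf_sum/=.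
  by apply: eq_bigr => i _; rewrite h.
- rewrite [X in X @ _ --> _](_ : _ = pseries (fun m => Im (u m)) s).
    exact: entire_cvg.
  apply/funext => n; rewrite /pseries /series/= raddf_sum/=.
  by apply: eq_bigr => i _; rewrite h.
Qed.

End Expansion.

Section Green.
Import ComplexField.Normc.
Context {R : realType}.
Implicit Types (s r : R) (z w k : R[i]).

(** The coefficients of J_0(k r) as a power series in r^2. *)
Definition j0_coef k (m : nat) : R[i] :=
  (-1) ^+ m / (m`!%:R ^+ 2) * (k ^+ 2 / 4) ^+ m.

(** The coefficients in r^2 of the series that Y_0(k r) adds to its logarithmic
part, up to the factor 2 / pi. *)
Definition y0_coef k (m : nat) : R[i] :=
  (-1) ^+ m.+1 * (harmonic_number m)%:C / (m`!%:R ^+ 2) * (k ^+ 2 / 4) ^+ m.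

Lemma harmonic_number_bound m : 0 <= (harmonic_number m : R) <= m%:R.
Proof.
rewrite /harmonic_number sumr_ge0//=.
elim: m => [|m IH]; first by rewrite big_geq.
by rewrite big_nat_recr//= -[leRHS]natr1 lerD// invf_le1 ?ler1n ?ltr0n.
Qed.

Lemma norm_natC (n : nat) : `|n%:R : R[i]| = n%:R.
Proof. by rewrite normr_nat. Qed.

Lemma natC (n : nat) : (n%:R : R)%:C = n%:R :> R[i].
Proof. by rewrite rmorph_nat. Qed.

Lemma majorantC (C M : R) (m : nat) :
  (C * M ^+ m / m`!%:R)%:C = C%:C * M%:C ^+ m / m`!%:R.
Proof. by rewrite !rmorphM/= fmorphV/= rmorphXn/= natC. Qed.

Lemma centire_j0 k : centire (j0_coef k).
Proof.
pose M := normc (k ^+ 2 / 4).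
have M0 : 0 <= M by rewrite -lecR -normC_normc normr_ge0.
apply: (@centire_bound _ _ 1 M) => // m.
rewrite /j0_coef normrM normf_div !normrX normrN1 expr1n.
rewrite (normC_normc (_ / _)) -/M norm_natC majorantC mul1r rmorph1 mul1r mulrC.
rewrite ler_wpM2l ?exprn_ge0 ?lecR//.
rewrite lef_pV2 ?posrE ?exprn_gt0 ?ltr0n ?fact_gt0//.
by rewrite expr2 ler_peMl ?ler0n// ler1n fact_gt0.
Qed.

(** Since H_m <= m <= m!, the harmonic number absorbs one of the two
factorials. *)
Lemma centire_y0 k : centire (y0_coef k).
Proof.
pose M := normc (k ^+ 2 / 4).
have M0 : 0 <= M by rewrite -lecR -normC_normc normr_ge0.
apply: (@centire_bound _ _ 1 M) => // m.
rewrite /y0_coef normrM normf_div normrM !normrX normrN1 expr1n.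
rewrite (normC_normc (_ / _)) -/M norm_natC majorantC mul1r rmorph1 mul1r mulrC.
have /andP[h0 h1] := harmonic_number_bound m.
rewrite (ger0_norm (x := (harmonic_number m)%:C)) ?lecR//.
rewrite ler_wpM2l ?exprn_ge0 ?lecR//.
rewrite ler_pdivrMr ?exprn_gt0 ?ltr0n ?fact_gt0// expr2 mulKf ?pnatr_eq0 -?lt0n ?fact_gt0//.
rewrite -natC lecR (le_trans h1)// ler_nat.
by case: (m) => // n; rewrite factS leq_pmulr ?fact_gt0.
Qed.

Lemma besselJ0_power k r : besselJ0 (k * r%:C) = cpsum (j0_coef k) (r ^+ 2).
Proof.
rewrite -csum_power; last exact: centire_j0.
congr csum; apply/funext => m.
rewrite /j0_coef -[RHS]mulrA; congr (_ * _).
by rewrite rmorphXn/= -exprMn; congr (_ ^+ _); rewrite exprMn mulrAC.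
Qed.

Lemma besselY0_power k r : besselY0 (k * r%:C) =
  (2 / pi)%:C * ((clog (k * r%:C / 2) + euler_gamma%:C) * cpsum (j0_coef k) (r ^+ 2))
  + (2 / pi)%:C * cpsum (y0_coef k) (r ^+ 2).
Proof.
rewrite /besselY0 besselJ0_power; congr (_ + _ * _).
rewrite -csum_power; last exact: centire_y0.
congr csum; apply/funext => m.
rewrite /y0_coef -[RHS]mulrA; congr (_ * _).
by rewrite rmorphXn/= -exprMn; congr (_ ^+ _); rewrite exprMn mulrAC.
Qed.

Lemma carg_pos k r : 0 < r -> carg (k * r%:C) = carg k.
Proof.
move=> r0; rewrite /carg normcM.
have -> : normc r%:C = r by rewrite /normc/= expr0n/= addr0 sqrtr_sqr gtr0_norm.
have -> : Re (k * r%:C) = Re k * r by case: k => x y /=; rewrite mulr0 subr0.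
have -> : Im (k * r%:C) = Im k * r by case: k => x y /=; rewrite mulr0 add0r.
by rewrite -mulf_div divff ?gt_eqF// mulr1 pmulr_lge0.
Qed.

Lemma clog_pos k r : k != 0 -> 0 < r -> clog (k * r%:C) = (ln r)%:C + clog k.
Proof.
move=> k0 r0; rewrite /clog carg_pos// normcM.
have -> : normc r%:C = r by rewrite /normc/= expr0n/= addr0 sqrtr_sqr gtr0_norm.
have nk : 0 < normc k.
  by rewrite -ltcR -normC_normc normr_gt0.
have -> : ln (normc k * r) = ln (normc k) + ln r by apply: lnM; rewrite posrE.
by apply/eqP; rewrite eq_complex/= add0r addrC !eqxx.
Qed.

(** The Green function is the sum of the series [green_regular] and of ln s times
the series [green_singular], with s = |x|^2. *)
Definition green_singular k (m : nat) : R[i] := - (4 * pi)^-1%:C * j0_coef k m.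

Definition green_regular k (m : nat) : R[i] :=
  ('i%C / 4 - (2 * pi)^-1%:C * (clog (k / 2) + euler_gamma%:C)) * j0_coef k m
  + - (2 * pi)^-1%:C * y0_coef k m.

Lemma centire_green_singular k : centire (green_singular k).
Proof. exact/centireZ/centire_j0. Qed.

Lemma centire_green_regular k : centire (green_regular k).
Proof. by apply: centireD; apply: centireZ; [exact: centire_j0|exact: centire_y0]. Qed.

(** For r > 0, clog (k r / 2) = ln r + clog (k / 2): the logarithm in Y_0 gives
ln r = ln s / 2 times a multiple of J_0, and all the rest is entire in s = r^2. *)
Lemma green_expansion k (x : R * R) : k != 0 -> 0 < x.1 ^+ 2 + x.2 ^+ 2 ->
  let s := x.1 ^+ 2 + x.2 ^+ 2 in
  green k x = cpsum (green_regular k) s + (ln s)%:C * cpsum (green_singular k) s.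
Proof.
move=> k0 s0 s; rewrite /green /hankel1_0 besselJ0_power besselY0_power.
have n0 : 0 < enorm x by rewrite sqrtr_gt0.
have -> : enorm x ^+ 2 = s by rewrite sqr_sqrtr// ltW.
rewrite (mulrAC k) clog_pos//; last by rewrite mulf_neq0// invr_neq0// pnatr_eq0.
have -> : (ln (enorm x))%:C = (ln s)%:C / 2.
  rewrite -[in RHS](_ : enorm x ^+ 2 = s); last by rewrite sqr_sqrtr// ltW.
  by rewrite lnXn// mulr2n rmorphD/=; field.
have cj := centire_j0 k; have cy := centire_y0 k.
rewrite /green_singular /green_regular.
rewrite cpsumD ?cpsumZ//; [|exact: centireZ..].
have i2 : 'i%C * 'i%C = -1 :> R[i] by rewrite -expr2 sqr_i.
have pi0 : (pi : R)%:C != 0 by rewrite fmorph_eq0 gt_eqF// pi_gt0.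
rewrite !fmorphV !rmorphM/= fmorphV/= !natC.
have split_i (A B : R[i]) : 'i%C / 4 * (A + 'i%C * B) = 'i%C / 4 * A - B / 4.
  rewrite mulrDr; congr (_ + _).
  by rewrite mulrACA mulrA i2; ring.
by rewrite split_i; move: (pi%:C : R[i]) pi0 => p0 p0n; field.
Qed.

End Green.

(** * Entire functions plus entire multiples of the logarithm *)

Section Profile.
Context {R : realType}.
Notation mu := (@lebesgue_measure R).

Lemma continuous_bounded_itv (f : R -> R) (u v : R) :
  (forall x, x \in `[u, v] -> {for x, continuous f}) ->
  exists2 M, 0 <= M & forall x, x \in `[u, v] -> `|f x| <= M.
Proof.
move=> cf; have [uv|vu] := leP u v; last first.
  exists 0 => // x; rewrite in_itv/= => /andP[h1 h2].
  by move: (le_trans h1 h2); rewrite leNgt vu.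
have cf' : {within `[u, v], continuous (fun x => `|f x|)}.
  apply: continuous_in_subspaceT => x; rewrite inE => /cf cfx.
  by apply: continuous_comp => //; exact: norm_continuous.
have [c cuv h] := EVT_max uv cf'.
by exists `|f c|.
Qed.

(** The kernels on the circle have a formula only off the diagonal; there s t = 0,
and the value c0 is whatever the definitions give. *)
Lemma measurable_positive_branch (h s : R -> R) (c0 : R) :
  (forall x, 0 < x -> {for x, continuous h}) -> continuous s ->
  measurable_fun setT (fun t => if 0 < s t then h (s t) else c0).
Proof.
move=> ch cs.
have mh : measurable_fun setT (fun x : R => if 0 < x then h x else c0).
  apply: measurable_fun_if => //.
  - exact: measurable_fun_ltr.
  - rewrite setTI (_ : _ @^-1` _ = `]0, +oo[%classic); last first.
      by apply/seteqP; split => x /=; rewrite in_itv/= andbT.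
    apply: open_continuous_measurable_fun; first exact: interval_open.
    by move=> x; rewrite inE/= in_itv/= andbT; exact: ch.
exact: (measurableT_comp mh (continuous_measurable_fun cs)).
Qed.

Variables p q : nat -> R.
Hypotheses (ep : entire_coef p) (eqq : entire_coef q).
Notation d := (@pseries_diffs R).

(** The shape of the real and imaginary parts of the Green function in terms of
the squared distance; [profile1] and [profile2] are the first two derivatives. *)
Definition profile (s : R) : R := @psum R p s + @ln R s * @psum R q s.

Definition profile1 (s : R) : R :=
  psum (d p) s + (s^-1 * psum q s + ln s * psum (d q) s).

Definition profile2 (s : R) : R :=
  psum (d (d p)) s + (2 * s^-1 * psum (d q) s - s^-2 * psum q s
    + ln s * psum (d (d q)) s).

Lemma psum_continuous (c : nat -> R) : entire_coef c -> continuous (psum c).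
Proof.
move=> ec s; apply/differentiable_continuous/derivable1_diffP.
by have [] := is_derive_psum s ec.
Qed.

Lemma is_derive_profile (s : R) : 0 < s -> is_derive s 1 profile (profile1 s).
Proof.
move=> s0; have dl := is_derive1_ln s0.
have dp := is_derive_psum s ep; have dq := is_derive_psum s eqq.
rewrite /profile /profile1; apply: is_derive_eq.
by rewrite /GRing.scale/=; ring.
Qed.

Lemma is_derive_profile1 (s : R) : 0 < s -> is_derive s 1 profile1 (profile2 s).
Proof.
move=> s0; have dl := is_derive1_ln s0.
have dV : is_derive s 1 (fun x : R => x^-1) (- s^-2).
  apply: is_derive_eq; first by apply: is_deriveV; rewrite gt_eqF.
  by rewrite /GRing.scale/= mulr1.
have dp := is_derive_psum s (entire_diffs ep).
have dq := is_derive_psum s eqq; have dq' := is_derive_psum s (entire_diffs eqq).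
rewrite /profile1 /profile2; apply: is_derive_eq.
by rewrite /GRing.scale/=; ring.
Qed.

Lemma continuous_profile2 (s : R) : 0 < s -> {for s, continuous profile2}.
Proof.
move=> s0; have cl : {for s, continuous (@ln R)} by exact: continuous_ln.
have cV : {for s, continuous (@GRing.inv R)} by apply: inv_continuous; rewrite gt_eqF.
have c1 : {for s, continuous (psum (d (d p)))} by exact/psum_continuous/entire_diffs/entire_diffs.
have c2 : {for s, continuous (psum (d q))} by exact/psum_continuous/entire_diffs.
have c3 : {for s, continuous (psum q)} by exact: psum_continuous.
have c4 : {for s, continuous (psum (d (d q)))} by exact/psum_continuous/entire_diffs/entire_diffs.
have c5 : {for s, continuous (fun x : R => x ^- 2)}.
  apply: (@cvg_comp _ _ _ (fun x : R => x ^+ 2) GRing.inv); first exact: exprn_continuous.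
  by apply: inv_continuous; rewrite expf_neq0// gt_eqF.
apply: cvgD => //; apply: cvgD; last exact: cvgM.
apply: cvgB; last exact: cvgM.
by apply: cvgM => //; apply: cvgM => //; exact: cvg_cst.
Qed.

Lemma continuous_profile1 (s : R) : 0 < s -> {for s, continuous profile1}.
Proof.
move=> /is_derive_profile1 [h _].
exact/differentiable_continuous/derivable1_diffP.
Qed.

Lemma continuous_profile (s : R) : 0 < s -> {for s, continuous profile}.
Proof.
move=> /is_derive_profile [h _].
exact/differentiable_continuous/derivable1_diffP.
Qed.

Lemma profile_log_bound (S : R) : exists2 M, 0 <= M &
  forall s, 0 < s <= S -> `|profile s| <= M * (1 + `|ln s|).
Proof.
have [M1 M10 h1] : exists2 M, 0 <= M & forall x, x \in `[0, S] -> `|psum p x| <= M.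
  by apply: continuous_bounded_itv => x _; exact: psum_continuous.
have [M2 M20 h2] : exists2 M, 0 <= M & forall x, x \in `[0, S] -> `|psum q x| <= M.
  by apply: continuous_bounded_itv => x _; exact: psum_continuous.
exists (M1 + M2); first exact: addr_ge0.
move=> s /andP[s0 sS]; have sin : s \in `[0, S] by rewrite in_itv/= ltW.
rewrite /profile (le_trans (ler_normD _ _))// normrM.
have := h1 _ sin; have := h2 _ sin => b2 b1.
have l0 : 0 <= `|ln s| by [].
have : `|ln s| * `|psum q s| <= `|ln s| * M2 by rewrite ler_wpM2l.
have : 0 <= M1 * `|ln s| by rewrite mulr_ge0.
by rewrite mulrDr mulr1 mulrDl; lra.
Qed.

Lemma abs_mul_ln (s : R) : 0 < s -> `|s * ln s| <= 1 + s ^+ 2.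
Proof.
move=> s0; have s2 : 0 <= s ^+ 2 by rewrite sqr_ge0.
have [s1|s1] := leP s 1.
  have /mul_ln_bound/andP[h1 h2] : 0 < s <= 1 by rewrite s0.
  by rewrite ler_norml; apply/andP; split; lra.
have l0 : 0 <= ln s by rewrite ln_ge0// ltW.
have l1 : ln s <= s by rewrite ltW// ln_sublinear.
rewrite ger0_norm ?mulr_ge0// ?(ltW s0)//.
have : s * ln s <= s * s by rewrite ler_pM2l.
by rewrite expr2; lra.
Qed.

(** The factor s cancels the pole of the derivative of ln s, and s ln s is
bounded. *)
Lemma profile1_bound (S : R) : exists2 M, 0 <= M &
  forall s, 0 < s <= S -> `|s * profile1 s| <= M.
Proof.
have [M1 M10 h1] : exists2 M, 0 <= M & forall x, x \in `[0, S] -> `|psum (d p) x| <= M.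
  by apply: continuous_bounded_itv => x _; exact/psum_continuous/entire_diffs.
have [M2 M20 h2] : exists2 M, 0 <= M & forall x, x \in `[0, S] -> `|psum q x| <= M.
  by apply: continuous_bounded_itv => x _; exact: psum_continuous.
have [M3 M30 h3] : exists2 M, 0 <= M & forall x, x \in `[0, S] -> `|psum (d q) x| <= M.
  by apply: continuous_bounded_itv => x _; exact/psum_continuous/entire_diffs.
have S2 : 0 <= 1 + S ^+ 2 by rewrite addr_ge0// sqr_ge0.
exists (`|S| * M1 + M2 + (1 + S ^+ 2) * M3).
  by rewrite !addr_ge0 ?mulr_ge0.
move=> s /andP[s0 sS]; have sin : s \in `[0, S] by rewrite in_itv/= ltW.
have -> : s * profile1 s = s * psum (d p) s + psum q s + (s * ln s) * psum (d q) s.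
  by rewrite /profile1; field; rewrite gt_eqF.
rewrite (le_trans (ler_normD _ _))// lerD//.
  rewrite (le_trans (ler_normD _ _))// lerD//; last exact: h2.
  rewrite normrM ler_pM//; last exact: h1.
  by rewrite !ger0_norm// ?ltW//; exact: lt_le_trans sS.
rewrite normrM ler_pM//; last exact: h3.
rewrite (le_trans (abs_mul_ln s0))// lerD2l lerXn2r// ?nnegrE ?(ltW s0)//.
exact: le_trans (ltW s0) sS.
Qed.

End Profile.

(** * Complex integrals over a period *)

Section ComplexIntegral.
Context {R : realType}.
Notation mu := (@lebesgue_measure R).
Notation D := (`[0, 2 * pi]%classic : set R).
Implicit Types (f g : R -> R[i]) (z : R[i]).

Let tau_gt0 : 0 < 2 * pi :> R. Proof. by rewrite mulr_gt0// pi_gt0. Qed.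

Definition cintegral f : R[i] :=
  (\int[mu]_(t in D) Re (f t))%R +i* (\int[mu]_(t in D) Im (f t))%R.

Definition cintegrable f :=
  mu.-integrable D (EFin \o (fun t => Re (f t))) /\
  mu.-integrable D (EFin \o (fun t => Im (f t))).

Definition cmeasurable f :=
  measurable_fun setT (fun t => Re (f t)) /\
  measurable_fun setT (fun t => Im (f t)).

Definition ccontinuous f :=
  continuous (fun t => Re (f t)) /\ continuous (fun t => Im (f t)).

Lemma eq_cintegral f g : {in D, f =1 g} -> cintegral f = cintegral g.
Proof.
by move=> fg; congr (_ +i* _); apply: eq_Rintegral => t tD; rewrite fg.
Qed.

Lemma eq_cintegrable f g : {in D, f =1 g} -> cintegrable f -> cintegrable g.
Proof.
move=> fg [h1 h2]; split; [apply: eq_integrable h1|apply: eq_integrable h2] => //;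
by move=> t tD; rewrite /= fg.
Qed.

Lemma integrable_lincomb (x y : R) (f g : R -> R) :
  mu.-integrable D (EFin \o f) -> mu.-integrable D (EFin \o g) ->
  mu.-integrable D (EFin \o (fun t => x * f t + y * g t)).
Proof.
move=> hf hg.
apply: (@integrableD _ _ R mu D _ (fun t => (x * f t)%:E) (fun t => (y * g t)%:E)) => //.
  exact: (@integrableZl _ _ R mu D _ x (EFin \o f)).
exact: (@integrableZl _ _ R mu D _ y (EFin \o g)).
Qed.

Lemma Rintegral_lincomb (x y : R) (f g : R -> R) :
  mu.-integrable D (EFin \o f) -> mu.-integrable D (EFin \o g) ->
  \int[mu]_(t in D) (x * f t + y * g t) =
  x * (\int[mu]_(t in D) f t) + y * \int[mu]_(t in D) g t.
Proof.
move=> hf hg; rewrite RintegralD ?RintegralZl//.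
- exact: (@integrableZl _ _ R mu D _ x (EFin \o f)).
- exact: (@integrableZl _ _ R mu D _ y (EFin \o g)).
Qed.

Lemma cintegrableZ z f : cintegrable f -> cintegrable (fun t => z * f t).
Proof.
move=> [h1 h2]; split.
  by rewrite (_ : (fun t => _) = fun t => Re z * Re (f t) + - Im z * Im (f t));
    [exact: integrable_lincomb|apply/funext => t; rewrite ReM].
by rewrite (_ : (fun t => _) = fun t => Re z * Im (f t) + Im z * Re (f t));
  [exact: integrable_lincomb|apply/funext => t; rewrite ImM].
Qed.

Lemma cintegrableD f g : cintegrable f -> cintegrable g ->
  cintegrable (fun t => f t + g t).
Proof.
move=> [h1 h2] [h3 h4]; split.
  rewrite (_ : (fun t => _) = fun t => Re (f t) + Re (g t)); last first.
    by apply/funext => t; rewrite raddfD.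
  exact: (@integrableD _ _ R mu D _ (fun t => (Re (f t))%:E) (fun t => (Re (g t))%:E)).
rewrite (_ : (fun t => _) = fun t => Im (f t) + Im (g t)); last first.
  by apply/funext => t; rewrite raddfD.
exact: (@integrableD _ _ R mu D _ (fun t => (Im (f t))%:E) (fun t => (Im (g t))%:E)).
Qed.

Lemma cintegralZ z f : cintegrable f -> cintegral (fun t => z * f t) = z * cintegral f.
Proof.
move=> [h1 h2]; rewrite /cintegral.
under eq_Rintegral do rewrite ReM.
under [X in _ +i* X]eq_Rintegral do rewrite ImM.
by rewrite !Rintegral_lincomb//; apply/eqP; rewrite eq_complex ReM ImM/= !eqxx.
Qed.

Lemma cintegralD f g : cintegrable f -> cintegrable g ->
  cintegral (fun t => f t + g t) = cintegral f + cintegral g.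
Proof.
move=> [h1 h2] [h3 h4]; rewrite /cintegral.
under eq_Rintegral do rewrite raddfD/=.
under [X in _ +i* X]eq_Rintegral do rewrite raddfD/=.
by rewrite !RintegralD.
Qed.

Lemma ccontinuousM f g : ccontinuous f -> ccontinuous g ->
  ccontinuous (fun t => f t * g t).
Proof.
move=> [f1 f2] [g1 g2]; split => t.
  under eq_fun do rewrite ReM mulNr.
  by apply: cvgB; apply: cvgM; [exact: f1|exact: g1|exact: f2|exact: g2].
under eq_fun do rewrite ImM.
by apply: cvgD; apply: cvgM; [exact: f1|exact: g2|exact: f2|exact: g1].
Qed.

Lemma ccontinuous_measurable f : ccontinuous f -> cmeasurable f.
Proof. by move=> [f1 f2]; split; exact: continuous_measurable_fun. Qed.

Lemma integrable_continuous (f : R -> R) : continuous f ->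
  mu.-integrable D (EFin \o f).
Proof.
move=> cf; apply: continuous_compact_integrable; first exact: segment_compact.
exact: continuous_subspaceT.
Qed.

Lemma ccontinuous_integrable f : ccontinuous f -> cintegrable f.
Proof. by move=> [f1 f2]; split; exact: integrable_continuous. Qed.

Lemma cintegral_periodic f x : cmeasurable f -> (forall t, f (t + 2 * pi) = f t) ->
  x \in `[0, 2 * pi] -> cintegral (fun y => f (y - x)) = cintegral f.
Proof.
move=> [m1 m2] fp; rewrite in_itv/= => xD; congr (_ +i* _); rewrite /Rintegral; congr fine.
- apply: (@integral_periodic R (2 * pi) (EFin \o (fun t => Re (f t)))) => //.
    exact/measurable_EFinP.
  by move=> t /=; rewrite fp.
- apply: (@integral_periodic R (2 * pi) (EFin \o (fun t => Im (f t)))) => //.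
    exact/measurable_EFinP.
  by move=> t /=; rewrite fp.
Qed.

Section Fubini.
Variables (F : R -> R -> R[i]) (g : R -> R).
Hypothesis mRe : measurable_fun setT (fun z : R * R => Re (F z.1 z.2)).
Hypothesis mIm : measurable_fun setT (fun z : R * R => Im (F z.1 z.2)).
Hypothesis mg : measurable_fun setT g.
Hypothesis gp : forall y, g (y + 2 * pi) = g y.
Hypothesis gN : forall y, g (- y) = g y.
Hypothesis ig : mu.-integrable D (EFin \o g).
Hypothesis FgRe : forall x y, D x -> D y -> `|Re (F x y)| <= g (x - y).
Hypothesis FgIm : forall x y, D x -> D y -> `|Im (F x y)| <= g (x - y).

Lemma cintegrable_fubini : cintegrable (fun x => cintegral (F x)).
Proof.
split.
  exact: (integrable_fubini tau_gt0 mRe mg gp gN ig FgRe).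
exact: (integrable_fubini tau_gt0 mIm mg gp gN ig FgIm).
Qed.

Lemma cfubini :
  cintegral (fun x => cintegral (F x)) = cintegral (fun y => cintegral (F^~ y)).
Proof.
apply: (congr2 (@Complex R)).
  exact: (fubini_periodic tau_gt0 mRe mg gp gN ig FgRe).
exact: (fubini_periodic tau_gt0 mIm mg gp gN ig FgIm).
Qed.

Lemma cintegrable_section1 x : D x -> cintegrable (F x).
Proof.
move=> Dx; split.
  exact: (integrable_section1 mRe mg gp gN ig FgRe Dx).
exact: (integrable_section1 mIm mg gp gN ig FgIm Dx).
Qed.

End Fubini.
End ComplexIntegral.

(** * Convolutions and exponentials *)

Section Modes.
Context {R : realType}.
Notation mu := (@lebesgue_measure R).
Notation D := (`[0, 2 * pi]%classic : set R).
Implicit Types (f g : R -> R[i]) (z w : R[i]) (n m : int).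

Definition mode n (t : R) : R[i] := cos (n%:~R * t) +i* sin (n%:~R * t).

Lemma mode_addt n s t : mode n (s + t) = mode n s * mode n t.
Proof.
rewrite /mode mulrDr cosD sinD; apply/eqP; rewrite eq_complex ReM ImM/=.
by rewrite mulNr eqxx/= addrC [X in X + _]mulrC [X in _ + X]mulrC addrC eqxx.
Qed.

Lemma mode_addn m n t : mode (m + n) t = mode m t * mode n t.
Proof.
rewrite /mode rmorphD/= mulrDl cosD sinD; apply/eqP; rewrite eq_complex ReM ImM/=.
by rewrite mulNr eqxx/= addrC eqxx.
Qed.

Lemma mode0 t : mode 0 t = 1.
Proof. by rewrite /mode mul0r cos0 sin0. Qed.

Lemma modeN n t : mode (- n) t = cos (n%:~R * t) -i* sin (n%:~R * t).
Proof. by rewrite /mode rmorphN/= mulNr cosN sinN. Qed.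

Lemma mode_periodic n t : mode n (t + 2 * pi) = mode n t.
Proof.
rewrite /mode mulrDr.
have -> : 2 * pi = pi *+ 2 :> R by rewrite mulr_natl.
case: n => n.
  by rewrite -pmulrn [n%:R * (pi *+ 2)]mulr_natl (periodicn (@cosD2pi R)) (periodicn (@sinD2pi R)).
rewrite NegzE rmorphN/= -pmulrn mulNr [X in _ + X]mulNr [n.+1%:R * (pi *+ 2)]mulr_natl.
rewrite -(periodicn (@cosD2pi R) n.+1) -(periodicn (@sinD2pi R) n.+1).
by rewrite subrK.
Qed.

Lemma mode_ccontinuous n : ccontinuous (mode n).
Proof.
have c (t : R) : {for t, continuous (fun t : R => n%:~R * t)}.
  by apply: cvgM; [exact: cvg_cst|exact: cvg_id].
split => t /=.
  exact: (continuous_comp (c t) (@continuous_cos R _)).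
exact: (continuous_comp (c t) (@continuous_sin R _)).
Qed.

(** A modulus with values in R, whose two terms are the real functions to be
integrated. *)
Definition abs1 z : R := `|Re z| + `|Im z|.

Lemma abs1_ge0 z : 0 <= abs1 z. Proof. by rewrite addr_ge0. Qed.

Lemma abs1M z w : abs1 (z * w) <= abs1 z * abs1 w.
Proof.
rewrite /abs1 ReM ImM (le_trans (lerD (ler_normD _ _) (ler_normD _ _)))//.
by rewrite !normrM normrN mulrDl !mulrDr; lra.
Qed.

Lemma Re_abs1 z : `|Re z| <= abs1 z. Proof. by rewrite lerDl. Qed.
Lemma Im_abs1 z : `|Im z| <= abs1 z. Proof. by rewrite lerDr. Qed.

Lemma abs1_bounded f : ccontinuous f ->
  exists2 M, 0 <= M & forall t, D t -> abs1 (f t) <= M.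
Proof.
move=> [f1 f2].
have cf : {within D, continuous (fun t => abs1 (f t))}.
  apply: continuous_subspaceT => t; apply: cvgD.
    by apply: (cvg_comp _ _ (f1 t)); exact: norm_continuous.
  by apply: (cvg_comp _ _ (f2 t)); exact: norm_continuous.
have p0 : 0 <= 2 * pi :> R by rewrite mulr_ge0// pi_ge0.
have [c cD h] := EVT_max p0 cf.
by exists (abs1 (f c)); [exact: abs1_ge0|move=> t Dt; exact: h].
Qed.

(** Evenness makes K (x - y) symmetric in x and y, so that a convolution and its
transpose have the same multipliers. *)
Definition circle_kernel (K : R -> R[i]) :=
  [/\ cmeasurable K, forall t, K (t + 2 * pi) = K t, forall t, K (- t) = K t
    & cintegrable K].

Definition convolution (K f : R -> R[i]) (x : R) : R[i] :=
  cintegral (fun y => K (x - y) * f y).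

Definition multiplier (K : R -> R[i]) n : R[i] :=
  cintegral (fun t => K t * mode n t).

Lemma cmeasurableM f g : cmeasurable f -> cmeasurable g ->
  cmeasurable (fun t => f t * g t).
Proof.
move=> [f1 f2] [g1 g2]; split.
  rewrite (_ : (fun t => _) = fun t => Re (f t) * Re (g t) - Im (f t) * Im (g t)).
    by apply: measurable_funB; exact: measurable_funM.
  by apply/funext => t; rewrite ReM mulNr.
rewrite (_ : (fun t => _) = fun t => Re (f t) * Im (g t) + Im (f t) * Re (g t)).
  by apply: measurable_funD; exact: measurable_funM.
by apply/funext => t; rewrite ImM.
Qed.

Section kernel.
Variables K : R -> R[i].
Hypothesis circleK : circle_kernel K.

Section product.
Variables f g : R -> R[i].
Hypotheses (cf : ccontinuous f) (cg : ccontinuous g).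

Let F x y : R[i] := K (x - y) * f y * g x.

Let mprod (h1 h2 h3 : R -> R) : measurable_fun setT h1 -> measurable_fun setT h2 ->
  measurable_fun setT h3 ->
  measurable_fun setT (fun v : R * R => h1 (v.1 - v.2) * h2 v.2 * h3 v.1).
Proof.
move=> m1 m2 m3; apply: measurable_funM; last first.
  by apply: (measurableT_comp m3); exact: measurable_fst.
apply: measurable_funM; last first.
  by apply: (measurableT_comp m2); exact: measurable_snd.
by apply: (measurableT_comp m1); apply: measurable_funB;
  [exact: measurable_fst|exact: measurable_snd].
Qed.

Let mRe : measurable_fun setT (fun v : R * R => Re (F v.1 v.2)).
Proof.
have [[k1 k2] _ _ _] := circleK.
have [f1 f2] := ccontinuous_measurable cf; have [g1 g2] := ccontinuous_measurable cg.
rewrite (_ : (fun v : R * R => _) = fun v : R * R =>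
    Re (K (v.1 - v.2)) * Re (f v.2) * Re (g v.1)
    - Im (K (v.1 - v.2)) * Im (f v.2) * Re (g v.1)
    - (Re (K (v.1 - v.2)) * Im (f v.2) * Im (g v.1)
    + Im (K (v.1 - v.2)) * Re (f v.2) * Im (g v.1))).
  apply: measurable_funB.
    by apply: measurable_funB; [exact: (mprod k1 f1 g1)|exact: (mprod k2 f2 g1)].
  by apply: measurable_funD; [exact: (mprod k1 f2 g2)|exact: (mprod k2 f1 g2)].
by apply/funext => v; rewrite /F !(ReM, ImM); ring.
Qed.

Let mIm : measurable_fun setT (fun v : R * R => Im (F v.1 v.2)).
Proof.
have [[k1 k2] _ _ _] := circleK.
have [f1 f2] := ccontinuous_measurable cf; have [g1 g2] := ccontinuous_measurable cg.
rewrite (_ : (fun v : R * R => _) = fun v : R * R =>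
    Re (K (v.1 - v.2)) * Re (f v.2) * Im (g v.1)
    - Im (K (v.1 - v.2)) * Im (f v.2) * Im (g v.1)
    + (Re (K (v.1 - v.2)) * Im (f v.2) * Re (g v.1)
    + Im (K (v.1 - v.2)) * Re (f v.2) * Re (g v.1))).
  apply: measurable_funD.
    by apply: measurable_funB; [exact: (mprod k1 f1 g2)|exact: (mprod k2 f2 g2)].
  by apply: measurable_funD; [exact: (mprod k1 f2 g1)|exact: (mprod k2 f1 g1)].
by apply/funext => v; rewrite /F !(ReM, ImM); ring.
Qed.

Let dominated : exists G : R -> R,
  [/\ measurable_fun setT G, forall y, G (y + 2 * pi) = G y, forall y, G (- y) = G y,
    mu.-integrable D (EFin \o G) &
    forall x y, D x -> D y -> abs1 (F x y) <= G (x - y)].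
Proof.
have [[k1 k2] Kp KN [i1 i2]] := circleK.
have [M M0 fM] := abs1_bounded cf; have [N N0 gN] := abs1_bounded cg.
exists (fun t => (M * N) * `|Re (K t)| + (M * N) * `|Im (K t)|); split.
- by apply: measurable_funD; apply: measurable_funM => //; exact: measurableT_comp.
- by move=> y; rewrite Kp.
- by move=> y; rewrite KN.
- by apply: integrable_lincomb;
    [apply: eq_integrable (integrable_abse i1)|apply: eq_integrable (integrable_abse i2)].
- move=> x y Dx Dy; rewrite /F -mulrDr -/(abs1 _) [leRHS]mulrC.
  rewrite (le_trans (abs1M _ _))// (le_trans (ler_wpM2r (abs1_ge0 _) (abs1M _ _)))//.
  rewrite -mulrA ler_wpM2l ?abs1_ge0//.
  by rewrite ler_pM ?abs1_ge0//; [exact: fM|exact: gN].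
Qed.

Lemma integrable_convolution_section x : D x ->
  cintegrable (fun y => K (x - y) * f y * g x).
Proof.
move=> Dx; have [G [mG Gp GN iG FG]] := dominated.
apply: (cintegrable_section1 mRe mIm mG Gp GN iG _ _ Dx) => u v Du Dv.
  exact: le_trans (Re_abs1 _) (FG _ _ Du Dv).
exact: le_trans (Im_abs1 _) (FG _ _ Du Dv).
Qed.

Lemma integrable_convolution_integral :
  cintegrable (fun x => cintegral (fun y => K (x - y) * f y * g x)).
Proof.
have [G [mG Gp GN iG FG]] := dominated.
apply: (cintegrable_fubini mRe mIm mG Gp GN iG) => u v Du Dv.
  exact: le_trans (Re_abs1 _) (FG _ _ Du Dv).
exact: le_trans (Im_abs1 _) (FG _ _ Du Dv).
Qed.

Lemma convolution_fubini :
  cintegral (fun x => cintegral (fun y => K (x - y) * f y * g x)) =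
  cintegral (fun y => cintegral (fun x => K (x - y) * f y * g x)).
Proof.
have [G [mG Gp GN iG FG]] := dominated.
apply: (cfubini mRe mIm mG Gp GN iG) => u v Du Dv.
  exact: le_trans (Re_abs1 _) (FG _ _ Du Dv).
exact: le_trans (Im_abs1 _) (FG _ _ Du Dv).
Qed.

End product.

Lemma ccontinuous1 : ccontinuous (fun=> 1 : R[i]).
Proof. by split => t; exact: cvg_cst. Qed.

Lemma convolution_integrand f x : ccontinuous f -> D x ->
  cintegrable (fun y => K (x - y) * f y).
Proof.
move=> cf Dx; have := integrable_convolution_section cf ccontinuous1 Dx.
by apply: eq_cintegrable => y _; rewrite mulr1.
Qed.

Lemma convolutionM f g x : ccontinuous f -> D x ->
  cintegral (fun y => K (x - y) * f y * g x) = convolution K f x * g x.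
Proof.
move=> cf Dx; rewrite mulrC -cintegralZ; last exact: convolution_integrand.
by apply: eq_cintegral => y _; rewrite mulrC.
Qed.

Lemma integrable_convolutionM f g : ccontinuous f -> ccontinuous g ->
  cintegrable (fun x => convolution K f x * g x).
Proof.
move=> cf cg; apply: eq_cintegrable (integrable_convolution_integral cf cg) => x.
by rewrite inE => Dx; exact: convolutionM.
Qed.

Lemma kernel_mode_integrable n : cintegrable (fun t => K t * mode n t).
Proof.
have D0 : D 0 by rewrite /= in_itv/= lexx mulr_ge0// pi_ge0.
have [_ _ KN _] := circleK.
have := convolution_integrand (mode_ccontinuous n) D0.
by apply: eq_cintegrable => y _; rewrite sub0r KN.
Qed.

(** As mode n y = mode n (y - x) * mode n x, this is a translation of the
integral over one period. *)
Lemma kernel_shift n x : D x ->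
  cintegral (fun y => K (y - x) * mode n y) = multiplier K n * mode n x.
Proof.
move=> Dx; have [mK Kp KN iK] := circleK.
rewrite mulrC -cintegralZ; last exact: kernel_mode_integrable.
rewrite -(@cintegral_periodic _ (fun y => mode n x * (K y * mode n y)) x)//.
- apply: eq_cintegral => y _.
  by rewrite [RHS]mulrCA -mode_addt (addrC x) subrK.
- apply: cmeasurableM; first by split; exact: measurable_cst.
  by apply: cmeasurableM => //; exact/ccontinuous_measurable/mode_ccontinuous.
- by move=> t; rewrite Kp mode_periodic.
Qed.

Lemma convolution_mode n x : D x ->
  convolution K (mode n) x = multiplier K n * mode n x.
Proof.
move=> Dx; have [_ _ KN _] := circleK; rewrite -kernel_shift//.
by apply: eq_cintegral => y _; rewrite -KN opprB.
Qed.

(** After the exchange of the integrals, the inner one is that of [kernel_shift]. *)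
Lemma coef_convolution f n : ccontinuous f ->
  cintegral (fun x => convolution K f x * mode n x) =
  multiplier K n * cintegral (fun x => f x * mode n x).
Proof.
move=> cf; have cm := mode_ccontinuous n.
transitivity (cintegral (fun x => cintegral (fun y => K (x - y) * f y * mode n x))).
  by apply: eq_cintegral => x; rewrite inE => Dx; rewrite convolutionM.
rewrite convolution_fubini// -cintegralZ; last first.
  exact/ccontinuous_integrable/ccontinuousM.
apply: eq_cintegral => y; rewrite inE => Dy.
transitivity (cintegral (fun x => f y * (K (x - y) * mode n x))).
  by apply: eq_cintegral => x _; rewrite mulrAC mulrC.
rewrite cintegralZ ?kernel_shift//; first by rewrite mulrCA.
have [mK Kp KN iK] := circleK.
apply: eq_cintegrable (convolution_integrand cm Dy) => x _.
by rewrite -KN opprB.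
Qed.

End kernel.
End Modes.

(** * Completeness of the exponentials *)

Section Completeness.
Context {R : realType}.
Notation mu := (@lebesgue_measure R).
Notation D := (`[0, 2 * pi]%classic : set R).

(** A trigonometric polynomial larger than 1 near t0 and of modulus at most 1 at
distance d or more: its powers concentrate at t0. *)
Definition bump (t0 d t : R) : R := 1 + cos (t - t0) - cos d.

Lemma bump_continuous t0 d : continuous (bump t0 d).
Proof.
move=> t; apply: cvgB; last exact: cvg_cst.
apply: cvgD; first exact: cvg_cst.
have c : {for t, continuous (fun t : R => t - t0)}.
  by apply: cvgB; [exact: cvg_id|exact: cvg_cst].
exact: (continuous_comp c (@continuous_cos R _)).
Qed.

Lemma bumpX_continuous t0 d N : continuous (fun t => bump t0 d t ^+ N).
Proof.
move=> t; apply: (@continuous_comp _ _ _ (bump t0 d) (fun x => x ^+ N)).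
  exact: bump_continuous.
exact: exprn_continuous.
Qed.

Lemma integrable_indicD (I : set R) : measurable I ->
  mu.-integrable D (EFin \o \1_I).
Proof.
move=> mI; apply: (@le_integrable _ _ R mu D _ _ (EFin \o cst 1)) => //.
- exact/measurable_EFinP/measurable_indic.
- by move=> t _; rewrite /= lee_fin !ger0_norm// indicE; case: (_ \in _).
- exact/integrable_continuous/cst_continuous.
Qed.

Lemma ler_cos_pi (x y : R) : 0 <= x -> x <= y -> y <= pi -> cos y <= cos x.
Proof.
move=> x0 xy yp.
by rewrite leNgt ltr_cos -?leNgt// in_itv/= ?x0 ?(le_trans xy)// (le_trans x0).
Qed.

Lemma cos_norm (x : R) : cos `|x| = cos x.
Proof.
have [h|h] := leP 0 x; first by rewrite ger0_norm.
by rewrite ltr0_norm ?cosN.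
Qed.

Section peak.
Variables (t0 d : R).
Hypotheses (d0 : 0 < d) (t0d : d <= t0) (t0d' : t0 + d <= 2 * pi) (dpi : d < pi).

Lemma bump_near t : `|t - t0| <= d / 2 ->
  1 + (cos (d / 2) - cos d) <= bump t0 d t.
Proof.
move: d0 t0d t0d' dpi => h0 h1 h2 h3.
move=> h; have pi0 := pi_gt0 R.
have : cos (d / 2) <= cos (t - t0) by rewrite -(cos_norm (t - t0)) ler_cos_pi//; lra.
by rewrite /bump; lra.
Qed.

Lemma bump_mid t : `|t - t0| <= d -> 1 <= bump t0 d t.
Proof.
move: d0 t0d t0d' dpi => h0 h1 h2 h3.
move=> h; have : cos d <= cos (t - t0) by rewrite -(cos_norm (t - t0)) ler_cos_pi// ltW.
by rewrite /bump; lra.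
Qed.

(** Within the period, |t - t0| lies between d and 2 pi - d, where the cosine is
at most cos d. *)
Lemma bump_far t : D t -> d <= `|t - t0| -> `|bump t0 d t| <= 1.
Proof.
move: d0 t0d t0d' dpi => h0 h1 h2 h3.
rewrite /= in_itv/= => /andP[t1 t2] h.
have hc : cos (t - t0) <= cos d.
  rewrite -(cos_norm (t - t0)); have [h4|h4] := leP `|t - t0| pi.
    by rewrite ler_cos_pi// ltW.
  have -> : cos `|t - t0| = cos (2 * pi - `|t - t0|).
    by rewrite -[LHS]cosN -[LHS](@cosD2pi R); congr cos; ring.
  rewrite ler_cos_pi//; first exact: ltW; last by lra.
  have [h5|h5] := leP t0 t; last by rewrite ltr0_norm ?subr_lt0//; lra.
  by rewrite ger0_norm ?subr_ge0//; lra.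
have := cos_geN1 (t - t0); have := cos_le1 d; have := cos_geN1 d => h4 h5 h6.
by rewrite /bump ler_norml; apply/andP; split; lra.
Qed.

(** For |t - t0| <= d / 2 the powers of the bump grow geometrically, and elsewhere
the integrand is at least - K, where K bounds |f|; the integrals would tend to
infinity. *)
Lemma peak_contradiction (f : R -> R) (m : R) : continuous f -> 0 < m ->
  (forall t, `|t - t0| <= d -> m <= f t) ->
  (forall N, \int[mu]_(t in D) (f t * bump t0 d t ^+ N) = 0) -> False.
Proof.
move: d0 t0d t0d' dpi => h0 h1 h2 h3.
move=> cf m0 fm f0; have pi0 := pi_gt0 R.
pose r : R := 1 + (cos (d / 2) - cos d).
have r1 : 1 < r.
  rewrite /r ltrDl subr_gt0 ltr_cos ?in_itv/=; last 2 first.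
  - by apply/andP; split; lra.
  - by apply/andP; split; lra.
  - lra.
have [K K0 hK] : exists2 K, 0 <= K & forall t, D t -> `|f t| <= K.
  have cf' : {within D, continuous (fun t => `|f t|)}.
    apply: continuous_subspaceT => t.
    by apply: (cvg_comp _ _ (cf t)); exact: norm_continuous.
  have [|c cD h] := EVT_max _ cf'; first lra.
  by exists `|f c|.
pose I : set R := `[t0 - d / 2, t0 + d / 2]%classic.
have lowN N : (m * r ^+ N + K) * d <= K * (2 * pi).
  have low : \int[mu]_(t in D) ((m * r ^+ N + K) * \1_I t + - K * cst 1 t) <= 0.
    rewrite -[leRHS](f0 N); apply: le_Rintegral => //.
    - apply: integrable_lincomb.
        apply: integrable_indicD; exact: measurable_itv.
      exact/integrable_continuous/cst_continuous.
    - apply: integrable_continuous => t; apply: cvgM; first exact: cf.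
      exact: bumpX_continuous.
    move=> t Dt /=; rewrite mulr1 indicE.
    have ft := hK _ Dt.
    have [tI|tI] := boolP (t \in I); rewrite ?mulr1 ?mulr0.
      have td : `|t - t0| <= d / 2.
        have := set_mem tI; rewrite /I /= in_itv/= ler_norml => /andP[? ?].
        by apply/andP; split; lra.
      rewrite addrK ler_pM ?(ltW m0) ?exprn_ge0 ?(le_trans _ (ltW r1))//.
        by apply: fm; lra.
      by rewrite lerXn2r ?nnegrE ?(le_trans _ (ltW r1))//;
        [rewrite (le_trans _ (bump_near td)) ?(le_trans _ (ltW r1))|exact: bump_near].
    rewrite add0r; have [h|h] := leP `|t - t0| d.
      rewrite (@le_trans _ _ 0) ?oppr_le0// mulr_ge0 ?exprn_ge0//.
        by rewrite (le_trans (ltW m0))// fm.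
      by rewrite (le_trans _ (bump_mid h)).
    have : `|f t * bump t0 d t ^+ N| <= K.
      rewrite normrM normrX -[leRHS]mulr1 ler_pM ?exprn_ge0//.
      by rewrite exprn_ile1// bump_far// ltW.
    by rewrite ler_norml => /andP[].
  move: low; rewrite Rintegral_lincomb; last 2 first.
  - apply: integrable_indicD; exact: measurable_itv.
  - exact/integrable_continuous/cst_continuous.
  rewrite Rintegral_cst// {1}/Rintegral integral_indic//=; last exact: measurable_itv.
  have -> : I `&` D = I.
    apply/setIidPl => t; rewrite /I/= !in_itv/= => /andP[h4 h5].
    by apply/andP; split; lra.
  rewrite /I !lebesgue_measure_itv/= !lte_fin ifT; last lra.
  rewrite ifT; last lra.
  by rewrite -!EFinB/= => h; lra.
have bern n : 1 + (r - 1) * n%:R <= r ^+ n.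
  elim: n => [|n IH]; first by rewrite mulr0 addr0.
  rewrite exprS -natr1; have n0 : 0 <= n%:R :> R by [].
  have : r * (1 + (r - 1) * n%:R) <= r * r ^+ n by rewrite ler_pM2l// (lt_trans _ r1).
  have : 0 <= (r - 1) ^+ 2 * n%:R by rewrite mulr_ge0// sqr_ge0.
  by rewrite expr2; lra.
have [k hk] : exists k : nat, K * (2 * pi) < m * d * ((r - 1) * k%:R).
  have q0 : 0 < m * d * (r - 1) by rewrite mulr_gt0 ?subr_gt0// mulr_gt0.
  exists (Num.truncn (K * (2 * pi) / (m * d * (r - 1)))).+1.
  by rewrite mulrA -ltr_pdivrMl// [ltLHS]mulrC truncnS_gt.
have := lowN k.
have : m * d * (1 + (r - 1) * k%:R) <= m * d * r ^+ k.
  by rewrite ler_pM2l// mulr_gt0.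
have : 0 <= K * d by rewrite mulr_ge0// ltW.
have : 0 < m * d by rewrite mulr_gt0.
rewrite mulrDr mulr1 mulrDl => h4 h5 h6 h7; move: hk.
lra.
Qed.

End peak.
(** The support of the peak must lie inside the period; as t0 may be an endpoint,
the bump is centred at a point t1 slightly closer to pi. *)
Lemma bump_complete_pos (g : R -> R) (t0 : R) : continuous g ->
  (forall t1 d N, \int[mu]_(t in D) (g t * bump t1 d t ^+ N) = 0) ->
  D t0 -> ~ 0 < g t0.
Proof.
rewrite /= in_itv/= => cg g0 /andP[t00 t02] gt0; have pi0 := pi_gt0 R.
have m0 : 0 < g t0 / 2 by lra.
have /cvgrPdist_lt/(_ _ m0) := cg t0.
move=> /nbhs_ballP[e /= e0 he].
(* t0 moves by at most pi l <= e / 2, and the half-width is pi l / 2. *)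
pose l : R := Num.min (1 / 2) (e / (2 * pi)).
have l0 : 0 < l by rewrite lt_min divr_gt0//= divr_gt0//; lra.
have l1 : l <= 1 / 2 by rewrite ge_min lexx.
have le : pi * l <= e / 2.
  have : l <= e / (2 * pi) by rewrite ge_min lexx orbT.
  by rewrite ler_pdivlMr; lra.
have pl : 0 < pi * l by rewrite mulr_gt0.
have pl2 : pi * l <= pi / 2.
  have h : pi * l <= pi * (1 / 2) by rewrite ler_pM2l.
  lra.
have tl0 : 0 <= t0 * l by rewrite mulr_ge0// ltW.
have tl1 : t0 * l <= 2 * pi * l by rewrite ler_pM2r.
have tl2 : t0 * l <= t0 * (1 / 2) by rewrite ler_wpM2l.
have tl3 : 0 <= (2 * pi - t0) * ((1 / 2) - l).
  by rewrite mulr_ge0//; lra.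
pose t1 := t0 + (pi - t0) * l.
apply: (@peak_contradiction t1 (pi * l / 2) _ _ _ _ g (g t0 / 2)) => //.
- by lra.
- by rewrite /t1; lra.
- by rewrite /t1; lra.
- by lra.
move=> t ht; have : ball t0 e t.
  move: ht; rewrite /ball/= /t1 !ltr_norml !ler_norml => /andP[h1 h2].
  by apply/andP; split; lra.
move=> /he /=; rewrite ltr_norml => /andP[h1 h2]; lra.
Qed.

Lemma bump_complete (g : R -> R) (t0 : R) : continuous g ->
  (forall t1 d N, \int[mu]_(t in D) (g t * bump t1 d t ^+ N) = 0) ->
  D t0 -> g t0 = 0.
Proof.
move=> cg g0 Dt; have [h|h|//] := ltgtP (g t0) 0; exfalso; last first.
  exact: (bump_complete_pos cg g0 Dt).
apply: (@bump_complete_pos (fun t => - g t) t0) => //; last by rewrite oppr_gt0.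
  by move=> t; apply: cvgN; exact: cg.
move=> t1 d N.
under eq_Rintegral do rewrite -mulN1r -mulrA.
rewrite RintegralZl ?g0 ?mulr0//.
apply: integrable_continuous => t; apply: cvgM; first exact: cg.
exact: bumpX_continuous.
Qed.

Lemma bump_modes (t0 d t : R) : (bump t0 d t)%:C =
  (1 - cos d)%:C + mode (- 1) t0 / 2 * mode 1 t + mode 1 t0 / 2 * mode (- 1) t.
Proof.
have -> : 2^-1 = (2^-1 : R)%:C :> R[i] by rewrite fmorphV rmorph_nat.
rewrite /bump cosB !modeN /mode !mul1r; apply/eqP; rewrite eq_complex.
by apply/andP; split; apply/eqP; rewrite /=; field.
Qed.

(** Multiplication by mode 1 or mode (-1) shifts the coefficients of f, and a bump
is a combination of these two and of 1. By induction all the coefficients of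
f times a power of a bump vanish, in particular its integral. *)
Lemma mode_complete (f : R -> R[i]) : ccontinuous f ->
  (forall n, cintegral (fun t => f t * mode n t) = 0) ->
  forall t, D t -> f t = 0.
Proof.
move=> cf f0.
have cb t0 d N : ccontinuous (fun t => ((bump t0 d t ^+ N)%:C : R[i])).
  by split => /=; [exact: bumpX_continuous|exact: cst_continuous].
have V t0 d N n : cintegral (fun t => f t * (bump t0 d t ^+ N)%:C * mode n t) = 0.
  elim: N n => [|N IH] n.
    by rewrite -[RHS](f0 n); apply: eq_cintegral => t _; rewrite expr0 mulr1.
  pose h m t := f t * (bump t0 d t ^+ N)%:C * mode m t.
  have ih m z : cintegrable (fun t => z * h m t).
    apply/cintegrableZ/ccontinuous_integrable/ccontinuousM; last exact: mode_ccontinuous.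
    exact: ccontinuousM.
  transitivity (cintegral (fun t => (1 - cos d)%:C * h n t
     + mode (- 1) t0 / 2 * h (1 + n) t + mode 1 t0 / 2 * h (- 1 + n) t)).
    apply: eq_cintegral => t _.
    rewrite exprS rmorphM/= bump_modes /h !mode_addn; ring.
  have hm m : cintegrable (h m).
    by apply: eq_cintegrable (ih m 1) => t _; rewrite mul1r.
  rewrite cintegralD//; last exact: cintegrableD.
  by rewrite cintegralD// !cintegralZ// !IH !mulr0 !addr0.
move=> t Dt.
have V0 t0 d N : cintegral (fun t => f t * (bump t0 d t ^+ N)%:C) = 0.
  by rewrite -[RHS](V t0 d N 0); apply: eq_cintegral => u _; rewrite mode0 mulr1.
apply/eqP; rewrite eq_complex; apply/andP; split; apply/eqP.
- apply: (@bump_complete (fun u => Re (f u)) t) => //; first by case: cf.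
  move=> t0 d N; rewrite -[RHS](congr1 (@Re R) (V0 t0 d N)).
  by apply: eq_Rintegral => u _; rewrite ReM/= mulr0 addr0.
- apply: (@bump_complete (fun u => Im (f u)) t) => //; first by case: cf.
  move=> t0 d N; rewrite -[RHS](congr1 (@Im R) (V0 t0 d N)).
  by apply: eq_Rintegral => u _; rewrite ImM/= mulr0 add0r.
Qed.

End Completeness.

(** * Derivatives of the kernels in the radial directions *)

Section RadialKernels.
Context {R : realType}.
Notation mu := (@lebesgue_measure R).
Notation D := (`[0, 2 * pi]%classic : set R).
Variable a : R.
Hypothesis a_gt0 : 0 < a.

Lemma chord2C (r b t : R) : chord2 r b t = chord2 b r t.
Proof. by rewrite /chord2; ring. Qed.

Lemma is_derive_chord2 (r b t : R) :
  is_derive b 1 (fun b => chord2 r b t) (2 * b - 2 * r * cos t).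
Proof.
rewrite /chord2; apply: is_derive_eq; rewrite /GRing.scale/=; ring.
Qed.

Lemma chord2_continuous (r b : R) : continuous (chord2 r b).
Proof.
move=> t; apply: cvgB; first exact: cvg_cst.
by apply: cvgM; [exact: cvg_cst|exact: continuous_cos].
Qed.

Lemma chord2_ge (r b t : R) : 0 <= r -> 0 <= b -> (r - b) ^+ 2 <= chord2 r b t.
Proof.
move=> r0 b0; have h : 0 <= r * b * (1 - cos t).
  by rewrite mulr_ge0 ?mulr_ge0// subr_ge0 cos_le1.
by rewrite /chord2; lra.
Qed.

Lemma chord2_le (r b t : R) : 0 <= r -> 0 <= b -> chord2 r b t <= (r + b) ^+ 2.
Proof.
move=> r0 b0; have h : 0 <= r * b * (1 + cos t).
  by rewrite mulr_ge0 ?mulr_ge0//; have := cos_geN1 t; lra.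
by rewrite /chord2; lra.
Qed.

Lemma chord2_gt0 (r t : R) : 0 < r -> r != a -> 0 < chord2 r a t.
Proof.
move=> r0 ra; apply: lt_le_trans (chord2_ge _ (ltW r0) (ltW a_gt0)).
by rewrite exprn_even_gt0//= subr_eq0.
Qed.

Variables p q : nat -> R.
Hypotheses (ep : entire_coef p) (eqq : entire_coef q).
Notation g0 := (profile p q).
Notation g1 := (profile1 p q).
Notation g2 := (profile2 p q).

(** For x at radius r and y on the circle, [normal_profile] is the derivative of a
profile of |x - y|^2 along n(y), and [normal2_profile] the derivative of the
latter in r. *)
Definition normal_profile (r t : R) : R :=
  g1 (chord2 r a t) * (2 * a - 2 * r * cos t).

Definition normal2_profile (r t : R) : R :=
  g2 (chord2 r a t) * (2 * r - 2 * a * cos t) * (2 * a - 2 * r * cos t)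
  + g1 (chord2 r a t) * (- 2 * cos t).

Lemma is_derive_profile_chord2 (r t : R) : 0 < chord2 r a t ->
  is_derive a 1 (fun b => g0 (chord2 r b t)) (normal_profile r t).
Proof.
move=> s0; have dg := is_derive_profile ep eqq s0.
have dc := is_derive_chord2 r a t.
exact: (@is_derive1_comp _ g0 (fun b => chord2 r b t) a _ _ dg dc).
Qed.

Lemma is_derive_normal_profile (r t : R) : 0 < chord2 r a t ->
  is_derive r 1 (fun r => normal_profile r t) (normal2_profile r t).
Proof.
move=> s0; have dg := is_derive_profile1 ep eqq s0.
have dc : is_derive r 1 (fun r => chord2 r a t) (2 * r - 2 * a * cos t).
  rewrite (_ : (fun r => _) = fun r => chord2 a r t).
    exact: is_derive_chord2.
  by apply/funext => r'; rewrite chord2C.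
have dgc : is_derive r 1 (fun r => g1 (chord2 r a t))
    (g2 (chord2 r a t) * (2 * r - 2 * a * cos t)).
  exact: (@is_derive1_comp _ g1 (fun r => chord2 r a t) r _ _ dg dc).
rewrite /normal_profile /normal2_profile; apply: is_derive_eq.
by rewrite /GRing.scale/=; ring.
Qed.

Lemma comp_chord2_continuous (g : R -> R) (r : R) :
  (forall s, 0 < s -> {for s, continuous g}) -> 0 < r -> r != a ->
  continuous (fun t => g (chord2 r a t)).
Proof.
move=> cg r0 ra t; apply: (@continuous_comp _ _ _ (chord2 r a) g).
  exact: chord2_continuous.
exact/cg/chord2_gt0.
Qed.

Lemma affine_cos_continuous (x y : R) : continuous (fun t : R => x - y * cos t).
Proof.
move=> t; apply: cvgB; first exact: cvg_cst.
by apply: cvgM; [exact: cvg_cst|exact: continuous_cos].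
Qed.

Lemma normal_profile_continuous (r : R) : 0 < r -> r != a ->
  continuous (normal_profile r).
Proof.
move=> r0 ra t; apply: cvgM; last exact: affine_cos_continuous.
by apply: comp_chord2_continuous => // s; exact: continuous_profile1.
Qed.

Lemma normal2_profile_continuous (r : R) : 0 < r -> r != a ->
  continuous (normal2_profile r).
Proof.
move=> r0 ra t; apply: cvgD; last first.
  apply: cvgM; last by apply: cvgM; [exact: cvg_cst|exact: continuous_cos].
  by apply: comp_chord2_continuous => // s; exact: continuous_profile1.
apply: cvgM; last exact: affine_cos_continuous.
apply: cvgM; last exact: affine_cos_continuous.
by apply: comp_chord2_continuous => // s; exact: continuous_profile2.
Qed.

(** At distance at least e from the circle, the squared distance stays in a
compact subset of the positive half line. *)
Lemma normal2_profile_bound (u v e : R) : 0 < u -> u < v -> 0 < e ->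
  (forall r, u < r < v -> e <= `|r - a|) ->
  exists2 M, 0 <= M & forall r t, u < r < v -> `|normal2_profile r t| <= M.
Proof.
move=> u0 uv e0 he.
have [M1 M10 h1] : exists2 M, 0 <= M &
    forall s, s \in `[e ^+ 2, (v + a) ^+ 2] -> `|g1 s| <= M.
  apply: continuous_bounded_itv => s; rewrite in_itv/= => /andP[es _].
  by apply: continuous_profile1 => //; apply: lt_le_trans es; rewrite exprn_gt0.
have [M2 M20 h2] : exists2 M, 0 <= M &
    forall s, s \in `[e ^+ 2, (v + a) ^+ 2] -> `|g2 s| <= M.
  apply: continuous_bounded_itv => s; rewrite in_itv/= => /andP[es _].
  by apply: continuous_profile2 => //; apply: lt_le_trans es; rewrite exprn_gt0.
pose L := 2 * v + 2 * a.
have v0 : 0 < v by exact: lt_trans uv.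
have a0 := a_gt0.
have L0 : 0 <= L by rewrite /L; lra.
exists (M2 * L * L + M1 * 2); first by rewrite addr_ge0// ?mulr_ge0.
move=> r t /andP[ur rv]; have r0 : 0 < r by exact: lt_trans ur.
have sin : chord2 r a t \in `[e ^+ 2, (v + a) ^+ 2].
  rewrite in_itv/=; apply/andP; split.
    apply: le_trans (chord2_ge _ (ltW r0) (ltW a_gt0)).
    rewrite -[leRHS](real_normK (num_real _)) lerXn2r ?nnegrE ?(ltW e0)// he// ur//.
  apply: (le_trans (chord2_le _ (ltW r0) (ltW a_gt0))).
  rewrite lerXn2r ?nnegrE; lra.
have bl (x y : R) : 0 <= x <= v + a -> 0 <= y <= v + a -> x + y <= v + a ->
    `|2 * x - 2 * y * cos t| <= L.
  move=> /andP[x0 _] /andP[y0 _] xy; rewrite /L.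
  have h3 : 0 <= y * (1 - cos t) by rewrite mulr_ge0// subr_ge0 cos_le1.
  have h4 : 0 <= y * (1 + cos t) by rewrite mulr_ge0//; have := cos_geN1 t; lra.
  by rewrite ler_norml; apply/andP; split; lra.
have b1 : `|2 * r - 2 * a * cos t| <= L.
  by apply: bl; try (apply/andP; split); lra.
have b2 : `|2 * a - 2 * r * cos t| <= L.
  by apply: bl; try (apply/andP; split); lra.
rewrite /normal2_profile (le_trans (ler_normD _ _))// lerD//.
  by rewrite !normrM ler_pM// ?mulr_ge0// ler_pM// h2.
rewrite normrM ler_pM// ?h1// normrM normrN (ger0_norm (x := 2))//.
by rewrite -[leRHS]mulr1 ler_pM2l// cos_max.
Qed.

Lemma integrable_profile_chord2 (c0 : R) : mu.-integrable D
  (EFin \o (fun t => if 0 < chord2 a a t then g0 (chord2 a a t) else c0)).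
Proof.
have [M M0 hM] := profile_log_bound ep eqq ((a + a) ^+ 2).
apply: (@le_integrable _ _ R mu D _ _
  (EFin \o (fun t => (M + `|c0|) * cst 1 t + M * `|ln (chord2 a a t)|))) => //.
- apply/measurable_EFinP/measurable_funTS.
  apply: measurable_positive_branch; last exact: chord2_continuous.
  by move=> s; exact: continuous_profile.
- move=> t Dt; rewrite /= lee_fin mulr1.
  have c00 : 0 <= `|c0| by [].
  have m0 : 0 <= M * `|ln (chord2 a a t)| by rewrite mulr_ge0.
  rewrite [leRHS]ger0_norm; last by rewrite !addr_ge0.
  case: ifPn => [s0|_]; last by lra.
  have := hM (chord2 a a t); rewrite s0 chord2_le ?(ltW a_gt0)//= => /(_ isT).
  by rewrite mulrDr mulr1; lra.
- apply: integrable_lincomb; first exact/integrable_continuous/cst_continuous.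
  by apply: eq_integrable (integrable_abse (integrable_ln_chord2 a_gt0)).
Qed.

(** On the circle, 2 a - 2 a cos t = s / a with s the squared distance, and this
factor cancels the pole of [profile1]: the kernel is bounded. *)
Lemma integrable_normal_profile (c0 : R) : mu.-integrable D
  (EFin \o (fun t => if 0 < chord2 a a t then normal_profile a t else c0)).
Proof.
have [M M0 hM] := profile1_bound ep eqq ((a + a) ^+ 2).
have E t : normal_profile a t = g1 (chord2 a a t) * (chord2 a a t / a).
  by rewrite /normal_profile /chord2; field; rewrite gt_eqF.
pose h s := g1 s * (s / a).
have -> : (fun t => if 0 < chord2 a a t then normal_profile a t else c0) =
  (fun t => if 0 < chord2 a a t then h (chord2 a a t) else c0).
  by apply/funext => t; rewrite E.
apply: (@le_integrable _ _ R mu D _ _ (EFin \o (fun=> M / a + `|c0|))) => //.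
- apply/measurable_EFinP/measurable_funTS.
  apply: (measurable_positive_branch (h := h)); last exact: chord2_continuous.
  move=> s s0; apply: cvgM; first exact: continuous_profile1.
  by apply: cvgM; [exact: cvg_id|exact: cvg_cst].
- move=> t Dt; rewrite /= lee_fin.
  have Ma : 0 <= M / a by rewrite divr_ge0// ltW.
  rewrite [leRHS]ger0_norm; last by rewrite addr_ge0.
  case: ifPn => [s0|_]; last by rewrite lerDr.
  rewrite /h.
  have := hM (chord2 a a t); rewrite s0 chord2_le ?(ltW a_gt0)//= => /(_ isT) hs.
  apply: le_trans (_ : M / a <= _); last by rewrite lerDl.
  rewrite mulrA mulrC normrM (gtr0_norm (x := a^-1)) ?invr_gt0//.
  by rewrite [leRHS]mulrC ler_pM2l ?invr_gt0// mulrC.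
- by apply: integrable_continuous => t; exact: cvg_cst.
Qed.

End RadialKernels.

Section UnderIntegral.
Context {R : realType}.
Notation mu := (@lebesgue_measure R).
Notation D := (`[0, 2 * pi]%classic : set R).

Lemma derive_under_integral (f df : R -> R -> R) (u v r0 M : R) :
  u < r0 < v -> 0 <= M ->
  (forall r, u < r < v -> continuous (f r)) ->
  (forall r y, u < r < v -> is_derive r 1 (f^~ y) (df r y)) ->
  (forall r y, u < r < v -> D y -> `|df r y| <= M) ->
  'D_1 (fun r => \int[mu]_(y in D) f r y) r0 = \int[mu]_(y in D) df r0 y.
Proof.
move=> ur0 M0 cf dfE bdf.
have inE' r : (`]u, v[%classic : set R) r -> u < r < v by rewrite /= in_itv.
rewrite -derive1E (@differentiation_under_integral _ _ _ mu f D _ r0 u v _ _ _ (fun=> M)) //.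
- by apply: eq_Rintegral => y _; rewrite partial1of2E; have [_ ->] := dfE _ y ur0.
- by move=> r /inE' ur; exact/integrable_continuous/cf.
- by move=> r y /inE' ur _; have [] := dfE _ y ur.
- by apply: integrable_continuous => t; exact: cvg_cst.
- move=> r y /inE' ur Dy; rewrite partial1of2E; have [_ ->] := dfE _ y ur.
  exact: bdf.
Qed.

(** The real and the imaginary part of the product of a complex kernel and a
complex density both have this two-term form. *)
Lemma derive_convolution_integral (p1 p2 d1 d2 : R -> R -> R) (v1 v2 : R -> R)
    (u v r b t N1 N2 M : R) :
  u < r < v -> 0 < b -> 0 <= N1 -> 0 <= N2 -> 0 <= M ->
  (forall x, u < x < v -> continuous (p1 x)) ->
  (forall x, u < x < v -> continuous (p2 x)) ->
  continuous v1 -> continuous v2 ->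
  (forall x s, u < x < v -> is_derive x 1 (p1^~ s) (d1 x s)) ->
  (forall x s, u < x < v -> is_derive x 1 (p2^~ s) (d2 x s)) ->
  (forall x s, u < x < v -> `|d1 x s| <= N1) ->
  (forall x s, u < x < v -> `|d2 x s| <= N2) ->
  (forall s, D s -> `|v1 s| <= M) -> (forall s, D s -> `|v2 s| <= M) ->
  'D_1 (fun x => \int[mu]_(s in D)
    ((p1 x (t - s) * v1 s + p2 x (t - s) * v2 s) * b)) r =
  \int[mu]_(s in D) ((d1 r (t - s) * v1 s + d2 r (t - s) * v2 s) * b).
Proof.
move=> urv b0 N10 N20 M0 cp1 cp2 cv1 cv2 dp1 dp2 bd1 bd2 bv1 bv2.
have ctr (g : R -> R) : continuous g -> continuous (fun s => g (t - s)).
  move=> cg s; apply: (@continuous_comp _ _ _ (fun s => t - s) g); last exact: cg.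
  by apply: cvgB; [exact: cvg_cst|exact: cvg_id].
have C0 : 0 <= (N1 * M + N2 * M) * b.
  by rewrite mulr_ge0 ?addr_ge0 ?mulr_ge0// ltW.
apply: (derive_under_integral
  (df := fun x s => (d1 x (t - s) * v1 s + d2 x (t - s) * v2 s) * b) urv C0).
- move=> x hx s; apply: cvgM; last exact: cvg_cst.
  by apply: cvgD; apply: cvgM;
    [exact: (ctr _ (cp1 _ hx))|exact: cv1|exact: (ctr _ (cp2 _ hx))|exact: cv2].
- move=> x s hx; have h1 := dp1 x (t - s) hx; have h2 := dp2 x (t - s) hx.
  by apply: is_derive_eq; rewrite /GRing.scale/=; ring.
- move=> x s hx Ds; rewrite normrM (gtr0_norm b0) ler_pM2r//.
  rewrite (le_trans (ler_normD _ _))// !normrM.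
  apply: lerD; apply: ler_pM => //.
  + exact: bd1.
  + exact: bv1.
  + exact: bd2.
  + exact: bv2.
Qed.

End UnderIntegral.

(** * Layer potentials as convolutions *)

Section Layers.
Context {R : realType}.
Notation mu := (@lebesgue_measure R).
Notation D := (`[0, 2 * pi]%classic : set R).
Notation plane := (R * R)%type.
Notation density := (plane -> R[i]).
Variables (c : plane) (a : R).
Hypothesis a_gt0 : 0 < a.

Definition polar (r t : R) : plane := c + (r * cos t, r * sin t).

Lemma polar_gamma t : gamma_param c a t = polar a t.
Proof. by []. Qed.

Lemma normal_gamma t : normal c a (gamma_param c a t) = (cos t, sin t).
Proof.
rewrite /normal /gamma_param addrC addKr.
by congr (_, _); rewrite /GRing.scale/= mulKf// gt_eqF.
Qed.

Lemma polarD (h r t : R) : h *: ((cos t, sin t) : plane) + polar r t = polar (h + r) t.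
Proof.
rewrite /polar addrCA; congr (_ + _).
by congr (_, _); rewrite /GRing.scale/= mulrDl.
Qed.

Definition radial_derive (f : R -> R[i]) (r : R) : R[i] :=
  'D_1 (fun b => Re (f b)) r +i* 'D_1 (fun b => Im (f b)) r.

(** A displacement along (cos t, sin t) changes only the radius. *)
Lemma cderive_radial (f : density) (r t : R) :
  cderive f (polar r t) (cos t, sin t) = radial_derive (fun b => f (polar b t)) r.
Proof.
rewrite /cderive /radial_derive /derive; congr (_ +i* _);
  congr (lim (_ @ 0^')); apply/funext => h;
  by rewrite /= polarD [h *: 1]mulr1.
Qed.

Definition radial_green (k : R[i]) (s : R) : R[i] :=
  'i%C / 4 * hankel1_0 (k * (Num.sqrt s)%:C).

Lemma green_polar k (r b t t' : R) :
  green k (polar r t - polar b t') = radial_green k (chord2 r b (t - t')).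
Proof.
rewrite /green /radial_green /enorm; congr (_ * hankel1_0 (_ * (Num.sqrt _)%:C)).
rewrite /polar /= /chord2 cosB.
have := cos2Dsin2 t; have := cos2Dsin2 t' => h' h.
rewrite -[X in _ = X - _](_ : r ^+ 2 * (cos t ^+ 2 + sin t ^+ 2) +
  b ^+ 2 * (cos t' ^+ 2 + sin t' ^+ 2) = _); last by rewrite h h' !mulr1.
ring.
Qed.

(** The kernels in terms of the angular distance t, for y on the circle and, in
[double_kernel] and [hyper_kernel], for x at radius r. The derivative at a is
the one along n(y), and that at r the one along n(x). *)
Definition single_kernel (k : R[i]) (t : R) : R[i] :=
  radial_green k (chord2 a a t).

Definition double_kernel (k : R[i]) (r t : R) : R[i] :=
  radial_derive (fun b => radial_green k (chord2 r b t)) a.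

Definition hyper_kernel (k : R[i]) (r t : R) : R[i] :=
  radial_derive (fun r => double_kernel k r t) r.

Lemma double_layer_kernel k (r t t' : R) :
  cderive (fun y => green k (polar r t - y)) (gamma_param c a t')
    (normal c a (gamma_param c a t')) = double_kernel k r (t - t').
Proof.
rewrite normal_gamma.
rewrite [LHS](cderive_radial (fun y => green k (polar r t - y)) a t').
apply: (congr1 (fun f => radial_derive f a)).
by apply/funext => b; exact: green_polar.
Qed.

(** When x and y are on the circle, moving x along n(x) changes |x - y|^2 as moving
y along n(y) does, by the symmetry of [chord2] in the radii. *)
Lemma adjoint_layer_kernel k (t t' : R) :
  cderive (fun x => green k (x - gamma_param c a t')) (gamma_param c a t)
    (normal c a (gamma_param c a t)) = double_kernel k a (t - t').
Proof.
rewrite normal_gamma.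
rewrite [LHS](cderive_radial (fun x => green k (x - polar a t')) a t).
apply: (congr1 (fun f => radial_derive f a)).
by apply/funext => b; rewrite (chord2C a b); exact: green_polar.
Qed.

Lemma cintE (f : density) :
  cint c a f = cintegral (fun t => f (gamma_param c a t) * a%:C).
Proof.
rewrite /cint /cintegral; congr (_ +i* _); apply: eq_Rintegral => t _.
  by rewrite ReM/= mulr0 addr0.
by rewrite ImM/= mulr0 add0r.
Qed.

Lemma single_layerE k psi t : single_layer c a k psi (gamma_param c a t) =
  cintegral (fun t' => single_kernel k (t - t') * psi (gamma_param c a t') * a%:C).
Proof.
rewrite /single_layer cintE; apply: eq_cintegral => t' _.
by rewrite green_polar.
Qed.

Lemma double_layerE k psi r t : double_layer c a k psi (polar r t) =
  cintegral (fun t' => double_kernel k r (t - t') * psi (gamma_param c a t') * a%:C).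
Proof.
rewrite /double_layer cintE; apply: eq_cintegral => t' _.
by rewrite double_layer_kernel.
Qed.

Lemma adjoint_double_layerE k psi t :
  adjoint_double_layer c a k psi (gamma_param c a t) =
  cintegral (fun t' => double_kernel k a (t - t') * psi (gamma_param c a t') * a%:C).
Proof.
rewrite /adjoint_double_layer cintE; apply: eq_cintegral => t' _.
by rewrite adjoint_layer_kernel.
Qed.

Section wavenumber.
Variable k : R[i].
Hypothesis k0 : k != 0.
Notation reP := (fun m => Re (green_regular k m)).
Notation imP := (fun m => Im (green_regular k m)).
Notation reQ := (fun m => Re (green_singular k m)).
Notation imQ := (fun m => Im (green_singular k m)).

Let erP : entire_coef reP. Proof. by have [] := centire_green_regular k. Qed.
Let eiP : entire_coef imP. Proof. by have [] := centire_green_regular k. Qed.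
Let erQ : entire_coef reQ. Proof. by have [] := centire_green_singular k. Qed.
Let eiQ : entire_coef imQ. Proof. by have [] := centire_green_singular k. Qed.

Lemma radial_green_profile (s : R) : 0 < s ->
  radial_green k s = profile reP reQ s +i* profile imP imQ s.
Proof.
move=> s0; have s2 : ((Num.sqrt s, 0) : plane).1 ^+ 2 + ((Num.sqrt s, 0) : plane).2 ^+ 2 = s.
  by rewrite /= expr0n/= addr0 sqr_sqrtr// ltW.
have := @green_expansion _ k (Num.sqrt s, 0) k0; rewrite s2 => /(_ s0) /= e.
transitivity (green k (Num.sqrt s, 0)).
  by rewrite /green /radial_green /enorm s2.
rewrite e /cpsum /profile; apply/eqP.
by rewrite eq_complex/= !mul0r !(subr0,addr0) !eqxx.
Qed.

Lemma near_chord2_gt0 (r t : R) : 0 < chord2 r a t ->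
  \forall b \near a, 0 < chord2 r b t.
Proof.
move=> s0; have cc : {for a, continuous (fun b => chord2 r b t)}.
  apply/differentiable_continuous/derivable1_diffP.
  by have [] := is_derive_chord2 r a t.
by apply: (cvgr_gt _ cc).
Qed.

Lemma double_kernel_profile (r t : R) : 0 < chord2 r a t ->
  double_kernel k r t =
  normal_profile a reP reQ r t +i* normal_profile a imP imQ r t.
Proof.
move=> s0; rewrite /double_kernel /radial_derive; congr (_ +i* _).
- rewrite (@near_eq_derive _ _ _ _ (fun b => profile reP reQ (chord2 r b t))).
    by have [] := is_derive_profile_chord2 erP erQ s0.
  near=> b; rewrite radial_green_profile//=.
  by near: b; exact: near_chord2_gt0.
- rewrite (@near_eq_derive _ _ _ _ (fun b => profile imP imQ (chord2 r b t))).
    by have [] := is_derive_profile_chord2 eiP eiQ s0.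
  near=> b; rewrite radial_green_profile//=.
  by near: b; exact: near_chord2_gt0.
Unshelve. all: by end_near. Qed.

Lemma near_off_circle (r : R) : 0 < r -> r != a ->
  \forall x \near r, 0 < x /\ x != a.
Proof.
move=> r0 ra.
have cs : (fun x : R => x - a) @ r --> r - a.
  by apply: cvgB; [exact: cvg_id|exact: cvg_cst].
have ra' : r - a != 0 by rewrite subr_eq0.
apply: filterS2 (lt_nbhsr r0) (cvgr_neq0 _ cs ra') => x x0.
by rewrite subr_eq0; split.
Qed.

Lemma hyper_kernel_profile (r t : R) : 0 < r -> r != a ->
  hyper_kernel k r t =
  normal2_profile a reP reQ r t +i* normal2_profile a imP imQ r t.
Proof.
move=> r0 ra; have s0 := chord2_gt0 a_gt0 t r0 ra.
rewrite /hyper_kernel /radial_derive; congr (_ +i* _).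
- rewrite (@near_eq_derive _ _ _ _ (fun r => normal_profile a reP reQ r t)).
    by have [] := is_derive_normal_profile erP erQ s0.
  near=> x; rewrite double_kernel_profile//.
  have [x0 xa] : 0 < x /\ x != a by near: x; exact: near_off_circle.
  exact: chord2_gt0.
- rewrite (@near_eq_derive _ _ _ _ (fun r => normal_profile a imP imQ r t)).
    by have [] := is_derive_normal_profile eiP eiQ s0.
  near=> x; rewrite double_kernel_profile//.
  have [x0 xa] : 0 < x /\ x != a by near: x; exact: near_off_circle.
  exact: chord2_gt0.
Unshelve. all: by end_near. Qed.

Lemma chord2_periodic (r b t : R) : chord2 r b (t + 2 * pi) = chord2 r b t.
Proof. by rewrite /chord2 [2 * pi]mulr_natl cosD2pi. Qed.

Lemma chord2N (r b t : R) : chord2 r b (- t) = chord2 r b t.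
Proof. by rewrite /chord2 cosN. Qed.

Lemma eq_double_kernel (r t t' : R) :
  (forall b, chord2 r b t = chord2 r b t') -> double_kernel k r t = double_kernel k r t'.
Proof.
move=> h; have E : (fun b => radial_green k (chord2 r b t)) =
    (fun b => radial_green k (chord2 r b t')) by apply/funext => b; rewrite h.
exact: (congr1 (fun f => radial_derive f a) E).
Qed.

Lemma double_kernel_periodic (r t : R) : double_kernel k r (t + 2 * pi) = double_kernel k r t.
Proof. by apply: eq_double_kernel => b; exact: chord2_periodic. Qed.

Lemma double_kernelN (r t : R) : double_kernel k r (- t) = double_kernel k r t.
Proof. by apply: eq_double_kernel => b; exact: chord2N. Qed.

Lemma eq_hyper_kernel (r t t' : R) :
  (forall r, double_kernel k r t = double_kernel k r t') ->
  hyper_kernel k r t = hyper_kernel k r t'.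
Proof.
move=> h; have E : (fun x => double_kernel k x t) = (fun x => double_kernel k x t').
  exact/funext.
exact: (congr1 (fun f => radial_derive f r) E).
Qed.

Lemma chord2_diag_ge0 (t : R) : 0 <= chord2 a a t.
Proof. by rewrite chord2E sqr_ge0. Qed.

Lemma single_circle_kernel : circle_kernel (single_kernel k).
Proof.
have -> : single_kernel k = fun t =>
    (if 0 < chord2 a a t then profile reP reQ (chord2 a a t) else Re (radial_green k 0))
    +i* (if 0 < chord2 a a t then profile imP imQ (chord2 a a t) else Im (radial_green k 0)).
  apply/funext => t; rewrite /single_kernel.
  case: ifPn => [s0|]; first exact: radial_green_profile.
  rewrite -leNgt => s0; have -> : chord2 a a t = 0.
    by apply/eqP; rewrite eq_le s0 chord2_diag_ge0.
  by case: radial_green.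
split.
- split => /=; (apply: measurable_positive_branch; last exact: chord2_continuous);
  by move=> s s0; exact: continuous_profile.
- by move=> t; rewrite chord2_periodic.
- by move=> t; rewrite chord2N.
- by split => /=; exact: integrable_profile_chord2.
Qed.

Lemma double_circle_kernel : circle_kernel (double_kernel k a).
Proof.
have E t : double_kernel k a t =
    (if 0 < chord2 a a t then normal_profile a reP reQ a t else Re (double_kernel k a 0))
    +i* (if 0 < chord2 a a t then normal_profile a imP imQ a t else Im (double_kernel k a 0)).
  case: ifPn => [s0|]; first exact: double_kernel_profile.
  rewrite -leNgt => s0; have s00 : chord2 a a t = 0.
    by apply/eqP; rewrite eq_le s0 chord2_diag_ge0.
  (* The chord vanishes only at multiples of 2 pi, where the kernel is the same. *)
  have ct : cos t = cos 0.
    move: s00; rewrite /chord2 cos0 => h.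
    have : 2 * a ^+ 2 * (1 - cos t) = 0 by rewrite -h; ring.
    move/eqP; rewrite mulf_eq0 gt_eqF ?mulr_gt0 ?exprn_gt0//= subr_eq0 => /eqP.
    by [].
  have -> : double_kernel k a t = double_kernel k a 0.
    by apply: eq_double_kernel => b; rewrite /chord2 ct.
  by case: double_kernel.
split.
- have mes p q c0 : entire_coef p -> entire_coef q -> measurable_fun setT
      (fun t => if 0 < chord2 a a t then normal_profile a p q a t else c0).
    move=> ep eqq.
    pose h s := profile1 p q s * (s / a).
    have -> : (fun t => if 0 < chord2 a a t then normal_profile a p q a t else c0) =
      (fun t => if 0 < chord2 a a t then h (chord2 a a t) else c0).
      apply/funext => t; case: ifP => // _; rewrite /h /normal_profile /chord2.
      by field; rewrite gt_eqF.
    apply: (measurable_positive_branch (h := h)); last exact: chord2_continuous.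
    move=> s s0; apply: cvgM; first exact: continuous_profile1.
    by apply: cvgM; [exact: cvg_id|exact: cvg_cst].
  split; [under eq_fun do rewrite E /=|under eq_fun do rewrite E /=]; exact: mes.
- by move=> t; rewrite double_kernel_periodic.
- by move=> t; rewrite double_kernelN.
- split.
    rewrite (_ : (fun t => Re _) = fun t => if 0 < chord2 a a t
      then normal_profile a reP reQ a t else Re (double_kernel k a 0)).
      exact: integrable_normal_profile.
    by apply/funext => t; rewrite E.
  rewrite (_ : (fun t => Im _) = fun t => if 0 < chord2 a a t
    then normal_profile a imP imQ a t else Im (double_kernel k a 0)).
    exact: integrable_normal_profile.
  by apply/funext => t; rewrite E.
Qed.

Lemma hyper_kernel_continuous (r : R) : 0 < r -> r != a ->
  ccontinuous (hyper_kernel k r).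
Proof.
move=> r0 ra.
have -> : hyper_kernel k r = fun t =>
  normal2_profile a reP reQ r t +i* normal2_profile a imP imQ r t.
  by apply/funext => t; exact: hyper_kernel_profile.
by split => /=; exact: normal2_profile_continuous.
Qed.

Lemma hyper_circle_kernel (r : R) : 0 < r -> r != a ->
  circle_kernel (hyper_kernel k r).
Proof.
move=> r0 ra; have ch := hyper_kernel_continuous r0 ra; split.
- exact: ccontinuous_measurable.
- by move=> t; apply: eq_hyper_kernel => x; exact: double_kernel_periodic.
- by move=> t; apply: eq_hyper_kernel => x; exact: double_kernelN.
- exact: ccontinuous_integrable.
Qed.

End wavenumber.
End Layers.

(** * The normal derivative of the double layer potential *)

Section Limits.
Context {R : realType}.

Lemma lim_near_eq (f g : R -> R[i]^o) (F : set_system R) {FF : Filter F} :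
  (\forall h \near F, f h = g h) -> lim (f @ F) = lim (g @ F).
Proof.
move=> fg; congr lim; apply/seteqP; split; first exact: near_eq_cvg.
by apply: near_eq_cvg; apply: filterS fg => h ->.
Qed.

(** When f has no limit, lim is the default value 0; then z f has no limit either
unless z = 0, and both sides vanish. *)
Lemma lim_scale (f : R -> R[i]^o) (z : R[i]) (F : set_system R) {FF : ProperFilter F} :
  lim ((fun h => f h * z : R[i]^o) @ F) = lim (f @ F) * z.
Proof.
have [->|z0] := eqVneq z 0.
  rewrite mulr0 [X in lim (X @ _)](_ : _ = cst 0); last first.
    by apply/funext => h; rewrite mulr0.
  exact: (@lim_cst R[i]^o).
have -> : (fun h => f h * z : R[i]^o) = (z : R[i]) *: f.
  by apply/funext => h; rewrite mulrC.
have [cf|ncf] := pselect (cvg (f @ F)).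
  by rewrite limZl_tmp// mulrC.
have ncz : ~ cvg ((z *: f) @ F) by rewrite is_cvgZlE.
by rewrite (dvgP ncf) (dvgP ncz) mul0r.
Qed.

End Limits.

Section Hyper.
Context {R : realType}.
Notation mu := (@lebesgue_measure R).
Notation D := (`[0, 2 * pi]%classic : set R).
Notation plane := (R * R)%type.
Notation density := (plane -> R[i]).
Variables (c : plane) (a : R).
Hypothesis a_gt0 : 0 < a.

Section wavenumber.
Variable k : R[i].
Hypothesis k0 : k != 0.
Notation trace psi := (fun t => psi (gamma_param c a t)).

(** Off the circle the kernel is smooth. The derivative passes under the integral
on an interval of radii around r that stays at distance e from a, where the
derivative of the kernel is bounded. *)
Lemma cderive_double_layer (psi : density) (r t : R) :
  ccontinuous (trace psi) -> 0 < r -> r != a -> 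
  cderive (double_layer c a k psi) (polar c r t) (cos t, sin t) =
  convolution (hyper_kernel a k r) (trace psi) t * a%:C.
Proof.
move=> cpsi r0 ra; rewrite cderive_radial.
have [c1 c2] := cpsi.
have [M M0 hM] := abs1_bounded cpsi.
pose e := Num.min (`|r - a| / 2) (r / 2).
have e0 : 0 < e by rewrite lt_min !divr_gt0// normr_gt0 subr_eq0.
have er : e <= r / 2 by rewrite ge_min lexx orbT.
have era : e <= `|r - a| / 2 by rewrite ge_min lexx.
have u0 : 0 < r - e by lra.
have uv : r - e < r + e by lra.
have far x : r - e < x < r + e -> e <= `|x - a|.
  move=> /andP[h1 h2].
  have : `|r - a| <= `|r - x| + `|x - a|.
    by rewrite (le_trans _ (ler_normD _ _))// addrA subrK.
  have : `|r - x| <= e by rewrite ler_norml; apply/andP; split; lra.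
  by lra.
have off x : r - e < x < r + e -> 0 < x /\ x != a.
  move=> hx; split; first by move: hx => /andP[h1 _]; exact: lt_trans h1.
  by have := far _ hx; rewrite -subr_eq0 -normr_gt0; exact: lt_le_trans.
have inr : r - e < r < r + e by apply/andP; split; lra.
have [eP eQ] := (centire_green_regular k, centire_green_singular k).
pose np1 := normal_profile a (fun m => Re (green_regular k m)) (fun m => Re (green_singular k m)).
pose np2 := normal_profile a (fun m => Im (green_regular k m)) (fun m => Im (green_singular k m)).
pose hp1 := normal2_profile a (fun m => Re (green_regular k m)) (fun m => Re (green_singular k m)).
pose hp2 := normal2_profile a (fun m => Im (green_regular k m)) (fun m => Im (green_singular k m)).
have dk x s : 0 < x /\ x != a -> double_kernel a k x s = np1 x s +i* np2 x s.
  by move=> [x0 xa]; apply: double_kernel_profile => //; exact: chord2_gt0.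
have hk x s : 0 < x /\ x != a -> hyper_kernel a k x s = hp1 x s +i* hp2 x s.
  by move=> [x0 xa]; exact: hyper_kernel_profile.
have [M1 M10 b1] : exists2 M, 0 <= M & forall x s, r - e < x < r + e -> `|hp1 x s| <= M.
  by apply: (normal2_profile_bound a_gt0 _ _ u0 uv e0 far); [case: eP|case: eQ].
have [M2 M20 b2] : exists2 M, 0 <= M & forall x s, r - e < x < r + e -> `|hp2 x s| <= M.
  by apply: (normal2_profile_bound a_gt0 _ _ u0 uv e0 far); [case: eP|case: eQ].
have ctr (g : R -> R) : continuous g -> continuous (fun s => g (t - s)).
  move=> cg s; apply: (@continuous_comp _ _ _ (fun s => t - s) g); last exact: cg.
  by apply: cvgB; [exact: cvg_cst|exact: cvg_id].
have cnp1 x : r - e < x < r + e -> continuous (np1 x).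
  by move=> /off [x0 xa]; apply: normal_profile_continuous => //; [case: eP|case: eQ].
have cnp2 x : r - e < x < r + e -> continuous (np2 x).
  by move=> /off [x0 xa]; apply: normal_profile_continuous => //; [case: eP|case: eQ].
have dnp1 x s : r - e < x < r + e -> is_derive x 1 (np1^~ s) (hp1 x s).
  move=> /off [x0 xa]; apply: is_derive_normal_profile; [by case: eP|by case: eQ|].
  exact: chord2_gt0.
have dnp2 x s : r - e < x < r + e -> is_derive x 1 (np2^~ s) (hp2 x s).
  move=> /off [x0 xa]; apply: is_derive_normal_profile; [by case: eP|by case: eQ|].
  exact: chord2_gt0.
have bM s : D s -> `|Re (trace psi s)| <= M /\ `|Im (trace psi s)| <= M.
  move=> Ds; split; apply: le_trans (hM _ Ds); [exact: Re_abs1|exact: Im_abs1].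
have eqDL x : (0 < x /\ x != a) -> double_layer c a k psi (polar c x t) =
   (\int[mu]_(s in D) ((np1 x (t - s) * Re (trace psi s)
      + np2 x (t - s) * - Im (trace psi s)) * a)) +i*
   (\int[mu]_(s in D) ((np1 x (t - s) * Im (trace psi s)
      + np2 x (t - s) * Re (trace psi s)) * a)).
  move=> hx; rewrite double_layerE// /cintegral; congr (_ +i* _); apply: eq_Rintegral => s _.
    by rewrite dk// !(ReM, ImM)/=; ring.
  by rewrite dk// !(ReM, ImM)/=; ring.
have nr' : \forall x \near r, 0 < x /\ x != a by exact: near_off_circle.
rewrite /radial_derive /convolution mulrC -cintegralZ; last first.
  apply: ccontinuous_integrable; apply: ccontinuousM => //.
  have [h1 h2] := hyper_kernel_continuous a_gt0 k0 r0 ra.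
  by split; [exact: (ctr _ h1)|exact: (ctr _ h2)].
rewrite /cintegral; congr (_ +i* _).
- rewrite (@near_eq_derive _ _ _ _ (fun x => \int[mu]_(s in D)
    ((np1 x (t - s) * Re (trace psi s) + np2 x (t - s) * - Im (trace psi s)) * a))); last first.
    by apply: filterS nr' => x hx; rewrite eqDL.
  rewrite (derive_convolution_integral (d1 := hp1) (d2 := hp2) (N1 := M1) (N2 := M2) t
    inr a_gt0 M10 M20 M0)//.
  + apply: eq_Rintegral => s _; rewrite hk// !(ReM, ImM)/=; ring.
  + by move=> s; apply: cvgN; exact: c2.
  + by move=> s /bM [].
  + by move=> s /bM []; rewrite normrN.
- rewrite (@near_eq_derive _ _ _ _ (fun x => \int[mu]_(s in D)
    ((np1 x (t - s) * Im (trace psi s) + np2 x (t - s) * Re (trace psi s)) * a))); last first.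
    by apply: filterS nr' => x hx; rewrite eqDL.
  rewrite (derive_convolution_integral (d1 := hp1) (d2 := hp2) (N1 := M1) (N2 := M2) t
    inr a_gt0 M10 M20 M0)//.
  + apply: eq_Rintegral => s _; rewrite hk// !(ReM, ImM)/=; ring.
  + by move=> s /bM [].
  + by move=> s /bM [].
Unshelve. all: by end_near. Qed.

End wavenumber.
End Hyper.

(** * The diagonal form of the Burton-Miller row *)

Section Diagonal.
Context {R : realType}.
Notation mu := (@lebesgue_measure R).
Notation D := (`[0, 2 * pi]%classic : set R).
Notation plane := (R * R)%type.
Notation density := (plane -> R[i]).
Variables (c : plane) (a : R).
Hypothesis a_gt0 : 0 < a.
Notation trace psi := (fun t => psi (gamma_param c a t)).

(** Two cases are of interest: a continuous density tested against a mode, and a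
mode tested against any test function. *)
Definition diagonal (n : int) (U X : R -> R[i]) : Prop :=
  [/\ ccontinuous U, ccontinuous X &
    forall K, circle_kernel K -> cintegral (fun t => convolution K U t * X t) =
      multiplier K n * cintegral (fun t => U t * X t)].

Lemma diagonal_test n U : ccontinuous U -> diagonal n U (mode n).
Proof.
move=> cU; split => //; first exact: mode_ccontinuous.
by move=> K cK; exact: coef_convolution.
Qed.

Lemma ccontinuousZ z f : ccontinuous f -> ccontinuous (fun t : R => z * f t).
Proof. by apply: ccontinuousM; split => t; exact: cvg_cst. Qed.

Lemma convolutionZ K z f t : circle_kernel K -> ccontinuous f -> D t ->
  convolution K (fun s => z * f s) t = z * convolution K f t.
Proof.
move=> cK cf Dt; rewrite -cintegralZ; last exact: convolution_integrand.
by apply: eq_cintegral => s _; rewrite mulrCA.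
Qed.

Lemma diagonal_mode n z X : ccontinuous X -> diagonal n (fun t => z * mode n t) X.
Proof.
move=> cX; have cm := mode_ccontinuous n.
split => //; first exact: ccontinuousZ.
move=> K cK; rewrite -cintegralZ; last first.
  by apply/ccontinuous_integrable/ccontinuousM => //; exact: ccontinuousZ.
apply: eq_cintegral => t; rewrite inE => Dt.
by rewrite convolutionZ// convolution_mode// !mulrA [z * _]mulrC.
Qed.

Lemma layer_convolution K f t : circle_kernel K -> ccontinuous f -> D t ->
  cintegral (fun s => K (t - s) * f s * a%:C) = a%:C * convolution K f t.
Proof.
move=> cK cf Dt; rewrite -cintegralZ; last exact: convolution_integrand.
by apply: eq_cintegral => s _; rewrite mulrC.
Qed.

Lemma pairingE (f chi : density) :
  pairing c a f chi = cintegral (fun t => trace f t * trace chi t * a%:C).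
Proof. by rewrite /pairing cintE. Qed.

Definition single_symbol k n : R[i] := a%:C * multiplier (single_kernel a k) n.
Definition double_symbol k n : R[i] := a%:C * multiplier (double_kernel a k a) n.
Definition hyper_symbol k n : R[i] :=
  lim ((fun h : R => a%:C * multiplier (hyper_kernel a k (h + a)) n : R[i]^o) @ 0^').

Section wavenumber.
Variable k : R[i].
Hypothesis k0 : k != 0.

Lemma single_layer_conv (psi : density) t : ccontinuous (trace psi) -> D t ->
  single_layer c a k psi (gamma_param c a t) =
  a%:C * convolution (single_kernel a k) (trace psi) t.
Proof.
move=> cpsi Dt; rewrite single_layerE//.
by rewrite (layer_convolution (single_circle_kernel a_gt0 k0) cpsi Dt).
Qed.

Lemma double_layer_conv (psi : density) t : ccontinuous (trace psi) -> D t ->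
  double_layer c a k psi (gamma_param c a t) =
  a%:C * convolution (double_kernel a k a) (trace psi) t.
Proof.
move=> cpsi Dt; rewrite polar_gamma double_layerE//.
by rewrite (layer_convolution (double_circle_kernel a_gt0 k0) cpsi Dt).
Qed.

Lemma adjoint_double_layer_conv (psi : density) t : ccontinuous (trace psi) -> D t ->
  adjoint_double_layer c a k psi (gamma_param c a t) =
  a%:C * convolution (double_kernel a k a) (trace psi) t.
Proof.
move=> cpsi Dt; rewrite adjoint_double_layerE//.
by rewrite (layer_convolution (double_circle_kernel a_gt0 k0) cpsi Dt).
Qed.

(** At height h over the circle the pairing is the multiplier of a convolution,
times a factor independent of h that [lim_scale] takes out of the limit. *)
Lemma hypersingular_diagonal n (psi chi : density) :
  diagonal n (trace psi) (trace chi) ->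
  hypersingular c a k psi chi =
  hyper_symbol k n * (a%:C * cintegral (fun t => trace psi t * trace chi t)).
Proof.
move=> [cpsi cchi diag]; rewrite /hypersingular /hyper_symbol -lim_scale.
apply: lim_near_eq.
have small : \forall h \near (0 : R)^', `|h| < a by exact: dnbhs0_lt.
have neq0 : \forall h \near (0 : R)^', h != 0 by exact: nbhs_dnbhs_neq.
apply: filterS2 small neq0 => h ha h0.
have r0 : 0 < h + a by move: ha; rewrite ltr_norml => /andP[? ?]; lra.
have ra : h + a != a by rewrite -subr_eq0 addrK.
have cK := hyper_circle_kernel a_gt0 k0 r0 ra.
rewrite pairingE.
transitivity (cintegral (fun t => (a%:C * a%:C) *
    (convolution (hyper_kernel a k (h + a)) (trace psi) t * trace chi t))).
  apply: eq_cintegral => t _.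
  rewrite normal_gamma// addrC polarD cderive_double_layer//; ring.
rewrite cintegralZ; last exact: integrable_convolutionM.
by rewrite diag//; ring.
Qed.

End wavenumber.

Variables (eps0 eps1 mu0 mu1 : R).

(** The multipliers of the row that the two operators share. *)
Definition row_u omega n : R[i] :=
  double_symbol (wavenumber eps0 mu0 omega) n - 2^-1 +
  alpha eps0 mu0 omega * hyper_symbol (wavenumber eps0 mu0 omega) n.

Definition row_q omega n : R[i] :=
  - (eps0%:C * (single_symbol (wavenumber eps0 mu0 omega) n
   + alpha eps0 mu0 omega * (double_symbol (wavenumber eps0 mu0 omega) n + 2^-1))).

Lemma burton_miller_diagonal omega n (u q chi : density) :
  wavenumber eps0 mu0 omega != 0 ->
  diagonal n (trace u) (trace chi) -> diagonal n (trace q) (trace chi) ->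
  burton_miller_row c a eps0 mu0 omega u q chi =
  (row_u omega n * cintegral (fun t => trace u t * trace chi t)
   + row_q omega n * cintegral (fun t => trace q t * trace chi t)) * a%:C.
Proof.
move=> k0 du dq.
rewrite /burton_miller_row (hypersingular_diagonal k0 du).
have [cu cchi hu] := du; have [cq _ hq] := dq.
set k := wavenumber eps0 mu0 omega in k0 *.
have cS := single_circle_kernel a_gt0 k0; have cD := double_circle_kernel a_gt0 k0.
have iu : cintegrable (fun t => trace u t * trace chi t).
  exact/ccontinuous_integrable/ccontinuousM.
have iq : cintegrable (fun t => trace q t * trace chi t).
  exact/ccontinuous_integrable/ccontinuousM.
have iDu := integrable_convolutionM cD cu cchi.
have iDq := integrable_convolutionM cD cq cchi.
have iSq := integrable_convolutionM cS cq cchi.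
have -> : pairing c a (fun x => double_layer c a k u x - u x / 2) chi =
    a%:C * (double_symbol k n - 2^-1) * cintegral (fun t => trace u t * trace chi t).
  rewrite pairingE.
  transitivity (cintegral (fun t => a%:C * a%:C *
       (convolution (double_kernel a k a) (trace u) t * trace chi t)
    + - (a%:C / 2) * (trace u t * trace chi t))).
    apply: eq_cintegral => t; rewrite inE => Dt.
    by rewrite double_layer_conv//; ring.
  rewrite cintegralD ?cintegralZ//; [|exact: cintegrableZ..].
  by rewrite hu// /double_symbol; ring.
have -> : pairing c a (fun x => single_layer c a k q x
      + alpha eps0 mu0 omega * (adjoint_double_layer c a k q x + q x / 2)) chi =
    a%:C * (single_symbol k n + alpha eps0 mu0 omega * (double_symbol k n + 2^-1))
     * cintegral (fun t => trace q t * trace chi t).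
  rewrite pairingE; set al := alpha eps0 mu0 omega.
  transitivity (cintegral (fun t => a%:C * a%:C *
       (convolution (single_kernel a k) (trace q) t * trace chi t)
    + (al * a%:C * a%:C * (convolution (double_kernel a k a) (trace q) t * trace chi t)
    + al * (a%:C / 2) * (trace q t * trace chi t)))).
    apply: eq_cintegral => t; rewrite inE => Dt.
    by rewrite single_layer_conv// adjoint_double_layer_conv//; ring.
  rewrite cintegralD; [|exact: cintegrableZ|by apply: cintegrableD; exact: cintegrableZ].
  rewrite cintegralD ?cintegralZ//; [|exact: cintegrableZ..].
  by rewrite !hq// /double_symbol /single_symbol; ring.
by rewrite /row_u /row_q -/k; ring.
Qed.

End Diagonal.

(** * Densities, test functions and the parametrization *)

Section Densities.
Context {R : realType}.
Notation mu := (@lebesgue_measure R).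
Notation D := (`[0, 2 * pi]%classic : set R).
Notation plane := (R * R)%type.
Notation density := (plane -> R[i]).
Variables (c : plane) (a : R).
Hypothesis a_gt0 : 0 < a.
Notation trace psi := (fun t => psi (gamma_param c a t)).

Lemma Gamma_gamma_param t : Gamma c a (gamma_param c a t).
Proof.
rewrite /Gamma /= /gamma_param addrC addKr /enorm/=.
rewrite !exprMn -mulrDr cos2Dsin2 mulr1 sqrtr_sqr gtr0_norm//.
Qed.

Lemma Gamma_param x : Gamma c a x -> exists2 t, D t & x = gamma_param c a t.
Proof.
rewrite /Gamma /= /enorm => hx; have pi0 := pi_gt0 R; have a0 := a_gt0.
set v := x - c in hx.
have v2 : v.1 ^+ 2 + v.2 ^+ 2 = a ^+ 2.
  by rewrite -hx sqr_sqrtr// addr_ge0// sqr_ge0.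
have hv t : v.1 = a * cos t -> v.2 = a * sin t -> x = gamma_param c a t.
  move=> h1 h2; rewrite /gamma_param -h1 -h2 -surjective_pairing /v.
  by rewrite addrC subrK.
pose y := v.1 / a.
have y1 : -1 <= y <= 1.
  rewrite -ler_norml -(@ler_pXn2r _ 2) ?nnegrE// expr1n.
  rewrite real_normK ?num_real// /y expr_div_n ler_pdivrMr ?exprn_gt0// mul1r -v2.
  by rewrite lerDl sqr_ge0.
have [/andP[t0 tp] ct] := acos_def y1.
have e1 : v.1 = a * cos (acos y) by rewrite ct /y mulrC divfK// gt_eqF.
have s2 : `|v.2| = a * sin (acos y).
  have s0 : 0 <= sin (acos y) by apply: sin_ge0_pi; rewrite t0.
  apply/eqP; rewrite -(@eqrXn2 _ 2) ?mulr_ge0 ?(ltW a0)//.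
  rewrite real_normK ?num_real// exprMn sin2cos2 mulrBr mulr1 -exprMn -e1 -v2.
  by rewrite addrC addKr.
have [v20|v20] := leP 0 v.2.
  exists (acos y); first by rewrite /= in_itv/= t0/=; lra.
  by apply: hv => //; rewrite -s2 ger0_norm.
exists (2 * pi - acos y); first by rewrite /= in_itv/=; apply/andP; split; lra.
apply: hv.
  rewrite e1; congr (_ * _); rewrite -[LHS]cosN -[LHS](@cosD2pi R).
  by congr cos; ring.
have -> : sin (2 * pi - acos y) = - sin (acos y).
  by rewrite -sinN -[RHS](@sinD2pi R); congr sin; ring.
by rewrite mulrN -s2 ltr0_norm// opprK.
Qed.

Lemma eq_density_trace (f g : density) :
  eq_density c a f g <-> (forall t, D t -> trace f t = trace g t).
Proof.
split=> [h t _|h x /Gamma_param[t Dt ->]]; last exact: h.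
exact/h/Gamma_gamma_param.
Qed.

Lemma gamma_continuous : continuous (gamma_param c a).
Proof.
move=> t; apply: cvgD; first exact: cvg_cst.
have h1 : (fun t => a * cos t) @ t --> a * cos t.
  by apply: cvgM; [exact: cvg_cst|exact: continuous_cos].
have h2 : (fun t => a * sin t) @ t --> a * sin t.
  by apply: cvgM; [exact: cvg_cst|exact: continuous_sin].
exact: cvg_pair h1 h2.
Qed.

Lemma continuous_density_trace (psi : density) :
  continuous_density c a psi -> ccontinuous (trace psi).
Proof.
move=> /subspace_continuousP cpsi.
have h t : (trace psi : R -> R[i]^o) @ t --> (trace psi t : R[i]^o).
  have cw : (gamma_param c a) @ t --> within (Gamma c a) (nbhs (gamma_param c a t)).
    move=> A /= hA.
    have : nbhs t (gamma_param c a @^-1` [set y | Gamma c a y -> A y]) := gamma_continuous hA.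
    by apply: filterS => s /= hs; apply: hs; exact: Gamma_gamma_param.
  exact: cvg_comp cw (cpsi _ (Gamma_gamma_param t)).
by split => t; [exact: (cvg_Re (h t))|exact: (cvg_Im (h t))].
Qed.

Lemma test_function_trace (chi : density) :
  test_function c a chi -> ccontinuous (trace chi).
Proof.
by move=> h; split => t; have [h1 h2] := h 0 t;
  apply/differentiable_continuous/derivable1_diffP.
Qed.

Definition plane_continuous (f : density) :=
  continuous (fun x => Re (f x)) /\ continuous (fun x => Im (f x)).

Lemma plane_continuous_density (f : density) :
  plane_continuous f -> continuous_density c a f.
Proof.
move=> [c1 c2]; apply: continuous_subspaceT => x.
by apply: cvgC; [exact: c1|exact: c2].
Qed.

Lemma plane_continuousM (f g : density) :
  plane_continuous f -> plane_continuous g -> plane_continuous (fun x => f x * g x).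
Proof.
move=> [f1 f2] [g1 g2]; split => x.
  under eq_fun do rewrite ReM mulNr.
  by apply: cvgB; apply: cvgM; [exact: f1|exact: g1|exact: f2|exact: g2].
under eq_fun do rewrite ImM.
by apply: cvgD; apply: cvgM; [exact: f1|exact: g2|exact: f2|exact: g1].
Qed.

Definition direction (s : R) (x : plane) : R[i] :=
  ((x.1 - c.1) / a) +i* (s * ((x.2 - c.2) / a)).

(** Powers of (x - c) / a, seen as a complex number, or of its conjugate: they
extend the exponentials to continuous functions on the plane. *)
Definition mode_density (n : int) (x : plane) : R[i] :=
  match n with
  | Posz m => direction 1 x ^+ m
  | Negz m => direction (- 1) x ^+ m.+1
  end.

Lemma direction_gamma s t : direction s (gamma_param c a t) = cos t +i* (s * sin t).
Proof.
rewrite /direction /gamma_param /=; congr (_ +i* (_ * _)).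
  by rewrite addrC addKr mulrC mulKf// gt_eqF.
by rewrite addrC addKr mulrC mulKf// gt_eqF.
Qed.

Lemma modeX (m : nat) (n : int) (t : R) : mode n t ^+ m = mode (n * m%:Z) t.
Proof.
elim: m => [|m IH]; first by rewrite mulr0 mode0.
by rewrite exprS IH intS mulrDr mulr1 mode_addn.
Qed.

Lemma mode_density_gamma n t : mode_density n (gamma_param c a t) = mode n t.
Proof.
case: n => m; rewrite /mode_density direction_gamma.
  rewrite -[RHS](_ : mode 1 t ^+ m = _); last by rewrite modeX mul1r.
  by rewrite /mode !mul1r.
rewrite -[RHS](_ : mode (- 1) t ^+ m.+1 = _); last by rewrite modeX mulN1r NegzE.
by rewrite /mode !mulN1r cosN sinN.
Qed.

Lemma direction_continuous s : plane_continuous (direction s).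
Proof.
split => x /=.
  apply: cvgM; last exact: cvg_cst.
  by apply: cvgB; [exact: cvg_fst|exact: cvg_cst].
apply: cvgM; first exact: cvg_cst.
apply: cvgM; last exact: cvg_cst.
by apply: cvgB; [exact: cvg_snd|exact: cvg_cst].
Qed.

Lemma plane_continuous_cst z : plane_continuous (fun=> z).
Proof. by split => x; exact: cvg_cst. Qed.

Lemma plane_continuousX (f : density) m :
  plane_continuous f -> plane_continuous (fun x => f x ^+ m).
Proof.
move=> cf; elim: m => [|m IH].
  exact: (plane_continuous_cst 1).
rewrite (_ : (fun x => _) = (fun x => f x * f x ^+ m)); first exact: plane_continuousM.
by apply/funext => x; rewrite exprS.
Qed.

Lemma mode_density_continuous z n :
  continuous_density c a (fun x => z * mode_density n x).
Proof.
apply/plane_continuous_density/plane_continuousM; first exact: plane_continuous_cst.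
by case: n => m; apply: plane_continuousX; exact: direction_continuous.
Qed.

Lemma derivable_trig (w x y : R) m t :
  derivable (derive1n m (fun s => x * cos (w * s) + y * sin (w * s))) t 1.
Proof.
elim: m x y => [|m IH] x y.
  rewrite derive1n0.
  have dl : is_derive t 1 (fun s : R => w * s) w.
    by apply: is_derive_eq; rewrite /GRing.scale/= mulr1.
  have dc : is_derive t 1 (fun s => cos (w * s)) (- sin (w * t) * w).
    exact: (@is_derive1_comp _ _ (fun s => w * s) t _ _ (is_derive_cos _) dl).
  have ds : is_derive t 1 (fun s => sin (w * s)) (cos (w * t) * w).
    exact: (@is_derive1_comp _ _ (fun s => w * s) t _ _ (is_derive_sin _) dl).
  exact: ex_derive.
rewrite derive1Sn.
have -> : derive1 (fun s => x * cos (w * s) + y * sin (w * s)) =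
    (fun s => (y * w) * cos (w * s) + (- (x * w)) * sin (w * s)).
  apply/funext => s; rewrite derive1E.
  have dl : is_derive s 1 (fun s : R => w * s) w.
    by apply: is_derive_eq; rewrite /GRing.scale/= mulr1.
  have dc : is_derive s 1 (fun s => cos (w * s)) (- sin (w * s) * w).
    exact: (@is_derive1_comp _ _ (fun s => w * s) s _ _ (is_derive_cos _) dl).
  have ds : is_derive s 1 (fun s => sin (w * s)) (cos (w * s) * w).
    exact: (@is_derive1_comp _ _ (fun s => w * s) s _ _ (is_derive_sin _) dl).
  by rewrite derive_val /GRing.scale/=; ring.
exact: IH.
Qed.

Lemma mode_density_test n : test_function c a (mode_density n).
Proof.
move=> m t; split.
- have -> : (fun s => Re (mode_density n (gamma_param c a s))) =
      (fun s => 1 * cos (n%:~R * s) + 0 * sin (n%:~R * s)).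
    by apply/funext => s; rewrite mode_density_gamma /= mul1r mul0r addr0.
  exact: derivable_trig.
- have -> : (fun s => Im (mode_density n (gamma_param c a s))) =
      (fun s => 0 * cos (n%:~R * s) + 1 * sin (n%:~R * s)).
    by apply/funext => s; rewrite mode_density_gamma /= mul1r mul0r add0r.
  exact: derivable_trig.
Qed.

Lemma trace_eq_coef (f g : density) :
  ccontinuous (trace f) -> ccontinuous (trace g) ->
  (forall n, cintegral (fun t => trace f t * mode n t) =
             cintegral (fun t => trace g t * mode n t)) ->
  eq_density c a f g.
Proof.
move=> cf cg fg; apply/eq_density_trace => t Dt; apply/eqP; rewrite -subr_eq0; apply/eqP.
have cg' : ccontinuous (fun t => -1 * trace g t) by exact: ccontinuousZ.
have cm := @mode_ccontinuous R.
apply: (@mode_complete _ (fun t => trace f t - trace g t)) => // [|n].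
  have [f1 f2] := cf; have [g1 g2] := cg; split => s.
    by under eq_fun do rewrite raddfB/=; apply: cvgB; [exact: f1|exact: g1].
  by under eq_fun do rewrite raddfB/=; apply: cvgB; [exact: f2|exact: g2].
have If := ccontinuous_integrable (ccontinuousM cf (cm n)).
have Ig := ccontinuous_integrable (ccontinuousM cg (cm n)).
transitivity (cintegral (fun t => trace f t * mode n t + -1 * (trace g t * mode n t))).
  by apply: eq_cintegral => s _; ring.
rewrite cintegralD ?cintegralZ ?fg//; first by ring.
exact: cintegrableZ.
Qed.

End Densities.

(** * Modal determinants and kernels of the two operators *)

Lemma sub_of_opp_add (V : zmodType) (x y v w : V) :
  - x + v = - y + w -> x - y = v - w.
Proof.
move=> h; have -> : v = x + (- y + w) by rewrite -h addrA subrr add0r.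
by rewrite addrA addrK.
Qed.

Section Operators.
Context {R : realType}.
Notation D := (`[0, 2 * pi]%classic : set R).
Notation plane := (R * R)%type.
Notation density := (plane -> R[i]).
Variables (c : plane) (a eps0 eps1 mu0 mu1 : R).
Hypotheses (a_gt0 : 0 < a) (eps0_gt0 : 0 < eps0) (eps1_gt0 : 0 < eps1).
Hypotheses (mu0_gt0 : 0 < mu0) (mu1_gt0 : 0 < mu1).
Notation trace psi := (fun t => psi (gamma_param c a t)).
Notation coef n psi := (cintegral (fun t => trace psi t * mode n t)).

Lemma wavenumber_neq0 (eps mu : R) (omega : R[i]) : 0 < eps -> 0 < mu ->
  admissible omega -> wavenumber eps mu omega != 0.
Proof.
move=> e0 m0 adm; rewrite /wavenumber mulf_neq0//.
  by apply: contra adm => /eqP->.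
by rewrite fmorph_eq0 gt_eqF// sqrtr_gt0 mulr_gt0.
Qed.

Variable omega : R[i].
Hypothesis adm : admissible omega.
Let k1 := wavenumber eps1 mu1 omega.
Let k0_neq0 : wavenumber eps0 mu0 omega != 0. Proof. exact: wavenumber_neq0. Qed.
Let k1_neq0 : k1 != 0. Proof. exact: wavenumber_neq0. Qed.

Let ru := row_u a eps0 mu0 omega.
Let rq := row_q a eps0 mu0 omega.
Let s n := single_symbol a k1 n.
Let d n := double_symbol a k1 n + 2^-1.

(** The determinant of the n-th block of A_BM, and eps1 times that of the n-th
block of A_mix. *)
Definition modal_determinant n : R[i] := ru n * (eps1%:C * s n) + rq n * d n.

Let eps1C_neq0 : eps1%:C != 0 :> R[i].
Proof. by rewrite fmorph_eq0 gt_eqF. Qed.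

Let row_coef n (u q : density) : ccontinuous (trace u) -> ccontinuous (trace q) ->
  burton_miller_row c a eps0 mu0 omega u q (mode_density c a n) =
  (ru n * coef n u + rq n * coef n q) * a%:C.
Proof.
move=> cu cq.
have E f : cintegral (fun t => trace f t * trace (mode_density c a n) t) = coef n f.
  by apply: eq_cintegral => t _; rewrite mode_density_gamma.
have dE (f : density) : ccontinuous (trace f) ->
    diagonal n (trace f) (trace (mode_density c a n)).
  move=> cf; rewrite (_ : trace (mode_density c a n) = mode n).
    exact: diagonal_test.
  by apply/funext => t; rewrite mode_density_gamma.
by rewrite (burton_miller_diagonal a_gt0 k0_neq0 (dE _ cu) (dE _ cq)) !E.
Qed.

Let row_mode n (x y : R[i]) (chi : density) : test_function c a chi ->
  ru n * x + rq n * y = 0 ->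
  burton_miller_row c a eps0 mu0 omega
    (fun v => x * mode_density c a n v) (fun v => y * mode_density c a n v) chi = 0.
Proof.
move=> /test_function_trace cchi xy.
have tE z : trace (fun v => z * mode_density c a n v) = fun t => z * mode n t.
  by apply/funext => t; rewrite mode_density_gamma.
have dE z : diagonal n (trace (fun v => z * mode_density c a n v)) (trace chi).
  by rewrite tE; exact: diagonal_mode.
rewrite (burton_miller_diagonal a_gt0 k0_neq0 (dE x) (dE y)).
have cm : cintegrable (fun t => mode n t * trace chi t).
  exact/ccontinuous_integrable/ccontinuousM/cchi/mode_ccontinuous.
have E z : cintegral (fun t => z * mode_density c a n (gamma_param c a t) * trace chi t) =
    z * cintegral (fun t => mode n t * trace chi t).
  by rewrite -cintegralZ//; apply: eq_cintegral => t _; rewrite mode_density_gamma// mulrA.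
by rewrite !E !mulrA -mulrDl xy !mul0r.
Qed.

Lemma single_layer_mode n z t : D t ->
  single_layer c a k1 (fun v => z * mode_density c a n v) (gamma_param c a t) =
  s n * z * mode n t.
Proof.
move=> Dt; have cK := single_circle_kernel a_gt0 k1_neq0.
have tE : trace (fun v => z * mode_density c a n v) = fun t => z * mode n t.
  by apply/funext => r; rewrite mode_density_gamma.
have cm := @mode_ccontinuous R n.
rewrite single_layer_conv// ?tE; last exact: ccontinuousZ.
by rewrite convolutionZ// convolution_mode// /s /single_symbol; ring.
Qed.

Lemma double_layer_mode n z t : D t ->
  double_layer c a k1 (fun v => z * mode_density c a n v) (gamma_param c a t) =
  double_symbol a k1 n * z * mode n t.
Proof.
move=> Dt; have cK := double_circle_kernel a_gt0 k1_neq0.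
have tE : trace (fun v => z * mode_density c a n v) = fun t => z * mode n t.
  by apply/funext => r; rewrite mode_density_gamma.
have cm := @mode_ccontinuous R n.
rewrite double_layer_conv// ?tE; last exact: ccontinuousZ.
by rewrite convolutionZ// convolution_mode// /double_symbol; ring.
Qed.

Lemma adjoint_double_layer_mode n z t : D t ->
  adjoint_double_layer c a k1 (fun v => z * mode_density c a n v) (gamma_param c a t) =
  double_symbol a k1 n * z * mode n t.
Proof.
move=> Dt; have cK := double_circle_kernel a_gt0 k1_neq0.
have tE : trace (fun v => z * mode_density c a n v) = fun t => z * mode n t.
  by apply/funext => r; rewrite mode_density_gamma.
have cm := @mode_ccontinuous R n.
rewrite adjoint_double_layer_conv// ?tE; last exact: ccontinuousZ.
by rewrite convolutionZ// convolution_mode// /double_symbol; ring.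
Qed.

Lemma coef_combination n (K : R -> R[i]) (f : R -> R[i]) (U V : R -> R[i]) (x y : R[i]) :
  circle_kernel K -> ccontinuous U -> ccontinuous V ->
  (forall t, D t -> f t = x * U t + y * convolution K V t) ->
  cintegrable (fun t => f t * mode n t) /\
  cintegral (fun t => f t * mode n t) =
  x * cintegral (fun t => U t * mode n t) +
  y * (multiplier K n * cintegral (fun t => V t * mode n t)).
Proof.
move=> cK cU cV hf; have cm := @mode_ccontinuous R n.
have iU := ccontinuous_integrable (ccontinuousM cU cm).
have iV := integrable_convolutionM cK cV cm.
have E t : t \in D -> x * (U t * mode n t) + y * (convolution K V t * mode n t) = f t * mode n t.
  by rewrite inE => Dt; rewrite hf//; ring.
split.
  by apply: eq_cintegrable E _; apply: cintegrableD; exact: cintegrableZ.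
rewrite -(eq_cintegral E) cintegralD ?cintegralZ ?coef_convolution//; exact: cintegrableZ.
Qed.

Lemma A_BM_second_coef n (u q : density) : ccontinuous (trace u) -> ccontinuous (trace q) ->
  coef n (A_BM c a eps0 eps1 mu0 mu1 omega (u, q)).2 =
  - d n * coef n u + eps1%:C * s n * coef n q.
Proof.
move=> cu cq; have cm := @mode_ccontinuous R n.
have cS := single_circle_kernel a_gt0 k1_neq0.
have cD := double_circle_kernel a_gt0 k1_neq0.
have [i1 e1] := @coef_combination n _ (fun t => - 2^-1 * trace u t
  + - a%:C * convolution (double_kernel a k1 a) (trace u) t) _ _ _ _ cD cu cu
  (fun _ _ => erefl).
have [i2 e2] := @coef_combination n _ (fun t => 0 * trace q t
  + eps1%:C * a%:C * convolution (single_kernel a k1) (trace q) t) _ _ _ _ cS cq cq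
  (fun _ _ => erefl).
transitivity (cintegral (fun t => (- 2^-1 * trace u t
  + - a%:C * convolution (double_kernel a k1 a) (trace u) t) * mode n t +
  (0 * trace q t + eps1%:C * a%:C * convolution (single_kernel a k1) (trace q) t) * mode n t)).
  apply: eq_cintegral => t; rewrite inE => Dt /=.
  by rewrite double_layer_conv// single_layer_conv//; ring.
by rewrite cintegralD// e1 e2 /d /s /double_symbol /single_symbol; ring.
Qed.

Lemma A_mix_second_coef n (u q phi : density) :
  ccontinuous (trace u) -> ccontinuous (trace phi) ->
  coef n (A_mix c a eps0 eps1 mu0 mu1 omega (u, q, phi)).1.2 =
  - coef n u + s n * coef n phi.
Proof.
move=> cu cphi; have cS := single_circle_kernel a_gt0 k1_neq0.
have [_ ->] := @coef_combination n _
  (trace (A_mix c a eps0 eps1 mu0 mu1 omega (u, q, phi)).1.2) _ _ (-1) a%:C cS cu cphi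
  (fun t Dt => ltac:(rewrite /= single_layer_conv// mulN1r; reflexivity)).
by rewrite /s /single_symbol; ring.
Qed.

Lemma A_mix_third_coef n (u q phi : density) :
  ccontinuous (trace q) -> ccontinuous (trace phi) ->
  coef n (A_mix c a eps0 eps1 mu0 mu1 omega (u, q, phi)).2 =
  - coef n q + eps1^-1%:C * d n * coef n phi.
Proof.
move=> cq cphi; have cm := @mode_ccontinuous R n.
have cD := double_circle_kernel a_gt0 k1_neq0.
have [i1 e1] := @coef_combination n _ (fun t => eps1^-1%:C / 2 * trace phi t
  + eps1^-1%:C * a%:C * convolution (double_kernel a k1 a) (trace phi) t) _ _ _ _ cD cphi cphi
  (fun _ _ => erefl).
have iq := ccontinuous_integrable (ccontinuousM cq cm).
transitivity (cintegral (fun t => -1 * (trace q t * mode n t) +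
  (eps1^-1%:C / 2 * trace phi t
  + eps1^-1%:C * a%:C * convolution (double_kernel a k1 a) (trace phi) t) * mode n t)).
  apply: eq_cintegral => t; rewrite inE => Dt /=.
  by rewrite adjoint_double_layer_conv//; ring.
rewrite cintegralD ?cintegralZ ?e1//; last exact: cintegrableZ.
by rewrite /d /double_symbol; ring.
Qed.

Lemma eq_density_coef n (f g : density) : eq_density c a f g -> coef n f = coef n g.
Proof.
move=> /(eq_density_trace c a_gt0 f g) fg; apply: eq_cintegral => t.
by rewrite inE => Dt; rewrite fg.
Qed.

Let row_coef_eq n (u q u' q' : density) :
  ccontinuous (trace u) -> ccontinuous (trace q) ->
  ccontinuous (trace u') -> ccontinuous (trace q') ->
  eq_distribution c a (burton_miller_row c a eps0 mu0 omega u q)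
    (burton_miller_row c a eps0 mu0 omega u' q') ->
  ru n * (coef n u - coef n u') + rq n * (coef n q - coef n q') = 0.
Proof.
move=> cu cq cu' cq' h.
have := h _ (mode_density_test c a_gt0 n); rewrite !row_coef//.
have aC : a%:C != 0 :> R[i] by rewrite fmorph_eq0 gt_eqF.
by move/(mulIf aC) => e; rewrite !mulrBr addrACA -opprD e subrr.
Qed.

(** Cramer's rule for the coefficients of the difference of two arguments with
the same image. *)
Lemma A_BM_injective_of_det : (forall n, modal_determinant n != 0) ->
  A_BM_injective c a eps0 eps1 mu0 mu1 omega.
Proof.
move=> det_neq0 [u q] [u' q'] [/= cu cq] [/= cu' cq'] [/= h1 h2].
have [{}cu {}cq] := (continuous_density_trace a_gt0 cu, continuous_density_trace a_gt0 cq).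
have [{}cu' {}cq'] := (continuous_density_trace a_gt0 cu', continuous_density_trace a_gt0 cq').
have sol n : coef n u = coef n u' /\ coef n q = coef n q'.
  have e1 := row_coef_eq n cu cq cu' cq' h1.
  have := eq_density_coef n h2; rewrite !A_BM_second_coef// => e2'.
  have e2 : - d n * (coef n u - coef n u') + eps1%:C * s n * (coef n q - coef n q') = 0.
    by rewrite !mulrBr addrACA -opprD e2' subrr.
  move: (coef n u - coef n u') (coef n q - coef n q') (subr_eq0 (coef n u) (coef n u'))
    (subr_eq0 (coef n q) (coef n q')) e1 e2 => x y hx hy e1 e2.
  have := det_neq0 n; rewrite /modal_determinant => dn.
  split; apply/eqP; rewrite -?hx -?hy; apply/eqP/(mulfI dn); rewrite mulr0.
    rewrite -[RHS](_ : eps1%:C * s n * (ru n * x + rq n * y)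
      - rq n * (- d n * x + eps1%:C * s n * y) = 0); last by rewrite e1 e2; ring.
    ring.
  rewrite -[RHS](_ : d n * (ru n * x + rq n * y)
      + ru n * (- d n * x + eps1%:C * s n * y) = 0); last by rewrite e1 e2; ring.
  ring.
by split => /=; apply: (trace_eq_coef a_gt0) => // n; have [] := sol n.
Qed.

(** The last two rows give the coefficients of u and q in terms of that of phi,
and the first row then says that the determinant annihilates it. *)
Lemma A_mix_injective_of_det : (forall n, modal_determinant n != 0) ->
  A_mix_injective c a eps0 eps1 mu0 mu1 omega.
Proof.
move=> det_neq0 [[u q] phi] [[u' q'] phi'] [[/= cu cq] /= cp] [[/= cu' cq'] /= cp'].
move=> [[/= h1 h2] /= h3].
have [{}cu {}cq] := (continuous_density_trace a_gt0 cu, continuous_density_trace a_gt0 cq).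
have [{}cu' {}cq'] := (continuous_density_trace a_gt0 cu', continuous_density_trace a_gt0 cq').
have [{}cp {}cp'] := (continuous_density_trace a_gt0 cp, continuous_density_trace a_gt0 cp').
have sol n : [/\ coef n u = coef n u', coef n q = coef n q' & coef n phi = coef n phi'].
  have e1 := row_coef_eq n cu cq cu' cq' h1.
  have := eq_density_coef n (h2 : eq_density c a
    (A_mix c a eps0 eps1 mu0 mu1 omega (u, q, phi)).1.2
    (A_mix c a eps0 eps1 mu0 mu1 omega (u', q', phi')).1.2).
  rewrite !A_mix_second_coef// => e2'.
  have := eq_density_coef n (h3 : eq_density c a
    (A_mix c a eps0 eps1 mu0 mu1 omega (u, q, phi)).2
    (A_mix c a eps0 eps1 mu0 mu1 omega (u', q', phi')).2).
  rewrite !A_mix_third_coef// => e3'.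
  have e2 : coef n u - coef n u' = s n * (coef n phi - coef n phi').
    by rewrite mulrBr; exact: sub_of_opp_add.
  have e3 : coef n q - coef n q' = eps1^-1%:C * d n * (coef n phi - coef n phi').
    by rewrite mulrBr; exact: sub_of_opp_add.
  have z0 : coef n phi - coef n phi' = 0.
    apply: (mulfI (det_neq0 n)); rewrite mulr0.
    rewrite -[RHS](mulr0 eps1%:C) -e1 e2 e3 /modal_determinant fmorphV.
    by move: (coef n phi - coef n phi') => z; field.
  by split; apply/eqP; rewrite -subr_eq0 ?e2 ?e3 z0 ?mulr0.
by split => [|/=]; first split => /=; apply: (trace_eq_coef a_gt0) => // n; have [] := sol n.
Qed.

Let cod2_zero n (x y : R[i]) : ru n * x + rq n * y = 0 ->
  - d n * x + eps1%:C * s n * y = 0 ->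
  eq_cod2 c a (A_BM c a eps0 eps1 mu0 mu1 omega
    ((fun v => x * mode_density c a n v), (fun v => y * mode_density c a n v))) 0.
Proof.
move=> e1 e2; split; first by move=> chi tchi /=; exact: row_mode.
apply/(eq_density_trace c a_gt0) => t Dt /=.
rewrite double_layer_mode// single_layer_mode// mode_density_gamma//.
transitivity ((- d n * x + eps1%:C * s n * y) * mode n t); last by rewrite e2 mul0r.
by rewrite /d; ring.
Qed.

Let cod3_zero n (x y z : R[i]) : ru n * x + rq n * y = 0 ->
  x = s n * z -> y = eps1^-1%:C * d n * z ->
  eq_cod3 c a (A_mix c a eps0 eps1 mu0 mu1 omega
    ((fun v => x * mode_density c a n v), (fun v => y * mode_density c a n v),
     (fun v => z * mode_density c a n v))) 0.
Proof.
move=> e1 e2 e3; split; first split.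
- by move=> chi tchi /=; exact: row_mode.
- apply/(eq_density_trace c a_gt0) => t Dt /=.
  by rewrite single_layer_mode// mode_density_gamma// e2; ring.
apply/(eq_density_trace c a_gt0) => t Dt /=.
by rewrite adjoint_double_layer_mode// mode_density_gamma// e3 /d; ring.
Qed.

Let zero_density n : (fun v => 0 * mode_density c a n v) = 0 :> (plane -> R[i]).
Proof. by apply/funext => v; rewrite mul0r. Qed.

Lemma A_BM_zero : eq_cod2 c a (A_BM c a eps0 eps1 mu0 mu1 omega 0) 0.
Proof.
have := @cod2_zero 0 0 0; rewrite !zero_density; apply.
  by rewrite !mulr0 addr0.
by rewrite !mulr0 addr0.
Qed.

Lemma A_mix_zero : eq_cod3 c a (A_mix c a eps0 eps1 mu0 mu1 omega 0) 0.
Proof.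
have := @cod3_zero 0 0 0 0; rewrite !zero_density; apply; rewrite ?mulr0//.
by rewrite addr0.
Qed.

Let mode_density_neq0 n z : eq_density c a (fun v => z * mode_density c a n v) 0 -> z = 0.
Proof.
move=> /(eq_density_trace c a_gt0) h.
have D0 : D 0 by rewrite /= in_itv/= lexx mulr_ge0// pi_ge0.
have := h 0 D0; rewrite mode_density_gamma// /mode mulr0 cos0 sin0.
by rewrite (_ : 1 +i* 0 = 1)// mulr1.
Qed.

(** A nonzero row (x, y) of the singular block provides the kernel vector
(y, - x); if both rows vanish, any vector is in the kernel. *)
Lemma A_BM_eigenvector n : modal_determinant n = 0 ->
  eigenfrequency (dom2 c a) (eq_dom2 c a) (eq_cod2 c a) (A_BM c a eps0 eps1 mu0 mu1) omega.
Proof.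
move=> det0.
suff [x [y [xy e1 e2]]] : exists x y : R[i], [/\ ~ (x = 0 /\ y = 0),
    ru n * x + rq n * y = 0 & - d n * x + eps1%:C * s n * y = 0].
  exists ((fun v => x * mode_density c a n v), (fun v => y * mode_density c a n v)); split.
  - by split; exact: mode_density_continuous.
  - by case=> /mode_density_neq0 x0 /mode_density_neq0 y0; exact: xy.
  - exact: cod2_zero.
have [sd|sd] := pselect (eps1%:C * s n = 0 /\ d n = 0).
  have [sn dn] := sd.
  have [rr|rr] := pselect (ru n = 0 /\ rq n = 0).
    exists 1, 0; split; first by move=> [/eqP]; rewrite oner_eq0.
      by rewrite rr.1 rr.2; ring.
    by rewrite sn dn; ring.
  exists (rq n), (- ru n); split.
  - by move=> [h1 /eqP]; rewrite oppr_eq0 => /eqP h2; exact: rr.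
  - ring.
  - by rewrite sn dn; ring.
exists (eps1%:C * s n), (d n); split => //.
ring.
Qed.

Lemma A_mix_eigenvector n : modal_determinant n = 0 ->
  eigenfrequency (dom3 c a) (eq_dom3 c a) (eq_cod3 c a) (A_mix c a eps0 eps1 mu0 mu1) omega.
Proof.
move=> det0.
exists ((fun v => s n * mode_density c a n v),
  (fun v => eps1^-1%:C * d n * mode_density c a n v), (fun v => 1 * mode_density c a n v)).
split.
- by split; [split|]; exact: mode_density_continuous.
- by case=> _ /mode_density_neq0 /eqP; rewrite oner_eq0.
- apply: cod3_zero; rewrite ?mulr1//.
  apply: (mulfI eps1C_neq0); rewrite mulr0 -[RHS]det0 /modal_determinant fmorphV.
  by field.
Qed.

(** One direction compares the argument with 0. The converse goes through the
determinants, as the limit in N^k gives no additivity at once. *)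
Lemma A_BM_injectiveP : A_BM_injective c a eps0 eps1 mu0 mu1 omega <->
  ~ eigenfrequency (dom2 c a) (eq_dom2 c a) (eq_cod2 c a) (A_BM c a eps0 eps1 mu0 mu1) omega.
Proof.
split.
  move=> inj [z [dz nz [h1 h2]]]; apply: nz.
  apply: (inj z 0 dz).
    by split; apply: plane_continuous_density; exact: (plane_continuous_cst 0).
  have [g1 g2] := A_BM_zero; split.
    by move=> chi tchi; rewrite h1// g1.
  by move=> x Gx; rewrite h2// g2.
move=> h; apply: A_BM_injective_of_det => n; apply/eqP => det0.
exact/h/A_BM_eigenvector/det0.
Qed.

Lemma A_mix_injectiveP : A_mix_injective c a eps0 eps1 mu0 mu1 omega <->
  ~ eigenfrequency (dom3 c a) (eq_dom3 c a) (eq_cod3 c a) (A_mix c a eps0 eps1 mu0 mu1) omega.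
Proof.
split.
  move=> inj [z [dz nz [[h1 h2] h3]]]; apply: nz.
  apply: (inj z 0 dz).
    by do 2?split; apply: plane_continuous_density; exact: (plane_continuous_cst 0).
  have [[g1 g2] g3] := A_mix_zero; split; first split.
  - by move=> chi tchi; rewrite h1// g1.
  - by move=> x Gx; rewrite h2// g2.
  - by move=> x Gx; rewrite h3// g3.
move=> h; apply: A_mix_injective_of_det => n; apply/eqP => det0.
exact/h/A_mix_eigenvector/det0.
Qed.

Lemma A_BM_eigenfrequencyP :
  eigenfrequency (dom2 c a) (eq_dom2 c a) (eq_cod2 c a) (A_BM c a eps0 eps1 mu0 mu1) omega <->
  exists n, modal_determinant n = 0.
Proof.
split=> [h|[n]]; last exact: A_BM_eigenvector.
apply: contrapT => nd; have /A_BM_injectiveP := A_BM_injective_of_det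
  (fun n => introN eqP (fun e => nd (ex_intro _ n e))).
exact.
Qed.

Lemma A_mix_eigenfrequencyP :
  eigenfrequency (dom3 c a) (eq_dom3 c a) (eq_cod3 c a) (A_mix c a eps0 eps1 mu0 mu1) omega <->
  exists n, modal_determinant n = 0.
Proof.
split=> [h|[n]]; last exact: A_mix_eigenvector.
apply: contrapT => nd; have /A_mix_injectiveP := A_mix_injective_of_det
  (fun n => introN eqP (fun e => nd (ex_intro _ n e))).
exact.
Qed.

End Operators.

Theorem proposition2 (R : realType) (c : R * R) (a eps0 eps1 mu0 mu1 : R) :
  0 < a -> 0 < eps0 -> 0 < eps1 -> 0 < mu0 -> 0 < mu1 ->
  (forall omega : R[i], admissible omega ->
     (A_mix_injective c a eps0 eps1 mu0 mu1 omega <->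
      A_BM_injective c a eps0 eps1 mu0 mu1 omega)) /\
  A_mix_eigenfrequencies c a eps0 eps1 mu0 mu1 =
  A_BM_eigenfrequencies c a eps0 eps1 mu0 mu1.
Proof.
move=> a0 e0 e1 m0 m1.
have same omega : admissible omega ->
    eigenfrequency (dom3 c a) (eq_dom3 c a) (eq_cod3 c a) (A_mix c a eps0 eps1 mu0 mu1) omega <->
    eigenfrequency (dom2 c a) (eq_dom2 c a) (eq_cod2 c a) (A_BM c a eps0 eps1 mu0 mu1) omega.
  move=> adm.
  have P2 := A_BM_eigenfrequencyP c a0 e0 e1 m0 m1 adm.
  have P3 := A_mix_eigenfrequencyP c a0 e0 e1 m0 m1 adm.
  exact: iff_trans P3 (iff_sym P2).
split=> [omega adm|].
  have I2 := A_BM_injectiveP c a0 e0 e1 m0 m1 adm.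
  have I3 := A_mix_injectiveP c a0 e0 e1 m0 m1 adm.
  have S := same _ adm.
  by split=> [/I3 h|/I2 h]; [apply/I2|apply/I3]; move=> e; apply: h; apply/S.
by apply/seteqP; split=> omega [adm /(same _ adm) h]; split.
Qed.
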